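(* Let $K$ be a flag simplicial complex on the vertex set $[m]=\{1,\dots,m\}$ and let $\underline{G}=(G_1,\dots,G_m)$ be a sequence of discrete groups. Then the group $\mathrm{Cart}(\underline{G},K)=\ker\big(\underline{G}^K\to\prod_{i=1}^m G_i\big)$ admits a presentation by $$N(\underline{G},K)=\sum_{J\subset[m]}n_J\cdot\widetilde b_0(K_J)$$ generators modulo $$M^+(\underline{G},K):=\sum_{J\subset[m]}n_J\cdot\operatorname{rank}\Pi_1(K_J)$$ relations, where $n_J:=\prod_{j\in J}|G_j\setminus\{1_j\}|$. In particular, $$\operatorname{def}\mathrm{Cart}(\underline{G},K)\le M^+(\underline{G},K)-N(\underline{G},K).$$
   Context: A simplicial complex $K$ on $[m]$ is a collection of subsets of $[m]$ (faces), closed under taking subsets, containing $\varnothing$ and all singletons $\{i\}$, $i\in[m]$. It is flag if $I\in K$ whenever $I\subset[m]$ and $\{i,j\}\in K$ for all $i,j\in I$. For $J\subset[m]$, $K_J=\{I\in K: I\subset J\}$ is the full subcomplex; topological notions applied to $K_J$ refer to its geometric realization $|K_J|$ ($|K_\varnothing|=\varnothing$). The graph product is $\underline{G}^K=(G_1\ast\dots\ast G_m)/(g_ig_j=g_jg_i \text{ for all } i\ne j,\ \{i,j\}\in K,\ g_i\in G_i,\ g_j\in G_j)$, and $\mathrm{Cart}(\underline{G},K)$ is the kernel of the natural projection $\underline{G}^K\to G_1\times\dots\times G_m$. Here $1_j$ is the identity of $G_j$, and $n_\varnothing=1$. $\widetilde b_0(X)=\dim_{\mathbb Q}\widetilde H_0(X;\mathbb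 Q)$ (so $\widetilde b_0(\varnothing)=0$). For a space $X$ with path components $\{X_\alpha\}$, $\Pi_1(X)$ is the free product of the groups $\pi_1(X_\alpha)$ over all $\alpha$ (trivial for $X=\varnothing$). The rank of a group $G$ is $\operatorname{rank}G=\inf|X|$ and its deficiency is $\operatorname{def}G=\inf(|R|-|X|)$, both infima being over all presentations $G=\langle X\mid R\rangle$. *)

(* Defs.v *)
From HB Require Import structures.
From mathcomp Require Import all_boot all_order all_algebra generic_quotient.
From mathcomp Require Import all_classical all_reals all_analysis.
From mathcomp Require Import homotopy ring lra.

Set Implicit Arguments.
Unset Strict Implicit.
Unset Printing Implicit Defensive.
Import Order.TTheory GRing.Theory Num.Theory.
Import numFieldNormedType.Exports.

Local Open Scope classical_set_scope.
Local Open Scope quotient_scope.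

(* A letter (x, true) stands for the generator x, (x, false) for its inverse. *)
Definition word (X : Type) := seq (X * bool).

Definition winv X (w : word X) : word X := rev [seq (l.1, ~~ l.2) | l <- w].

Definition weval X (G : groupType) (f : X -> G) (w : word X) : G :=
  (\prod_(l <- w) (if l.2 then f l.1 else (f l.1)^-1))%g.

Section PresentedGroup.
Variables (X : choiceType) (rel : set (word X)).

(* The least congruence on words that cancels x x^-1 and x^-1 x and kills rel:
   two words are related iff they agree in F(X) / <<rel>>. *)
Inductive pres_eq : word X -> word X -> Prop :=
| pres_refl w : pres_eq w w
| pres_sym v w : pres_eq v w -> pres_eq w v
| pres_trans u v w : pres_eq u v -> pres_eq v w -> pres_eq u w
| pres_cancel u v x b : pres_eq (u ++ [:: (x, b); (x, ~~ b)] ++ v) (u ++ v)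
| pres_rel u v r : rel r -> pres_eq (u ++ r ++ v) (u ++ v).

Definition pres_eqb : ssrbool.rel (word X) := fun v w => `[< pres_eq v w >].

Lemma pres_eqb_refl : reflexive pres_eqb.
Proof. by move=> w; apply/asboolP; exact: pres_refl. Qed.

Lemma pres_eqb_sym : ssrbool.symmetric pres_eqb.
Proof. by move=> v w; apply/asboolP/asboolP => /pres_sym. Qed.

Lemma pres_eqb_trans : ssrbool.transitive pres_eqb.
Proof.
by move=> v u w /asboolP uv /asboolP vw; apply/asboolP; exact: pres_trans vw.
Qed.

Canonical pres_equiv := EquivRel pres_eqb pres_eqb_refl pres_eqb_sym
  pres_eqb_trans.

(* < X | rel > *)
Definition pgroup := {eq_quot pres_equiv}.

HB.instance Definition _ := Choice.on pgroup.
HB.instance Definition _ := EqQuotient.on pgroup.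

Lemma pres_eqP v w : reflect (pres_eq v w) (\pi_pgroup v == \pi_pgroup w).
Proof. by rewrite piE; exact: asboolP. Qed.

Lemma pres_eq_catr u v w : pres_eq u v -> pres_eq (u ++ w) (v ++ w).
Proof.
elim=> {u v} [u|u v _|u v t _ uv _ vt|u v x b|u v r rr]; first exact: pres_refl.
- exact: pres_sym.
- exact: pres_trans vt.
- by rewrite -!catA; exact: pres_cancel.
- by rewrite -!catA; exact: pres_rel.
Qed.

Lemma pres_eq_catl u v w : pres_eq u v -> pres_eq (w ++ u) (w ++ v).
Proof.
elim=> {u v} [u|u v _|u v t _ uv _ vt|u v x b|u v r rr]; first exact: pres_refl.
- exact: pres_sym.
- exact: pres_trans vt.
- by rewrite !(catA w); exact: pres_cancel.
- by rewrite !(catA w); exact: pres_rel.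
Qed.

Lemma pres_eq_cat u u' v v' :
  pres_eq u u' -> pres_eq v v' -> pres_eq (u ++ v) (u' ++ v').
Proof.
move=> uu' vv'; apply: (@pres_trans _ (u' ++ v)); first exact: pres_eq_catr.
exact: pres_eq_catl.
Qed.

Lemma winv_catr w : pres_eq (w ++ winv w) [::].
Proof.
elim: w => [|[x b] w IHw]; first exact: pres_refl.
rewrite /winv /= rev_cons -cats1 -/(winv w) (catA w).
have : pres_eq ([:: (x, b)] ++ (w ++ winv w) ++ [:: (x, ~~ b)])
               ([:: (x, b)] ++ [::] ++ [:: (x, ~~ b)]).
  by apply: pres_eq_catl; exact: pres_eq_catr.
move/pres_trans; apply; exact: (@pres_cancel [::] [::]).
Qed.

Lemma winvK : involutive (@winv X).
Proof.
move=> w; rewrite /winv map_rev revK -map_comp -[RHS]map_id.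
by apply: eq_map => -[x b] /=; rewrite negbK.
Qed.

Lemma winv_catl w : pres_eq (winv w ++ w) [::].
Proof. by rewrite -{2}(winvK w); exact: winv_catr. Qed.

Lemma pres_eq_winv u v : pres_eq u v -> pres_eq (winv u) (winv v).
Proof.
move=> uv; apply: (@pres_trans _ (winv u ++ v ++ winv v)).
  rewrite -[X in pres_eq X]cats0.
  by apply/pres_eq_catl/pres_sym; exact: winv_catr.
rewrite catA -[X in pres_eq _ X]cat0s; apply: pres_eq_catr.
apply: (@pres_trans _ (winv u ++ u)); last exact: winv_catl.
by apply: pres_eq_catl; exact: pres_sym.
Qed.

Definition pgroup_one : pgroup := \pi_pgroup [::].
Definition pgroup_mul (a b : pgroup) : pgroup := \pi_pgroup (repr a ++ repr b).
Definition pgroup_inv (a : pgroup) : pgroup := \pi_pgroup (winv (repr a)).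

Lemma pgroup_mulE u v : pgroup_mul (\pi_pgroup u) (\pi_pgroup v) = \pi_pgroup (u ++ v).
Proof.
apply/eqP/pres_eqP/pres_eq_cat; apply/pres_eqP; by rewrite reprK.
Qed.

Lemma pgroup_invE u : pgroup_inv (\pi_pgroup u) = \pi_pgroup (winv u).
Proof. by apply/eqP/pres_eqP/pres_eq_winv/pres_eqP; rewrite reprK. Qed.

Lemma pgroup_mulA : associative pgroup_mul.
Proof.
move=> a b c; rewrite -[a]reprK -[b]reprK -[c]reprK.
move: (repr a) (repr b) (repr c) => u v w; rewrite (pgroup_mulE v) (pgroup_mulE u v) !pgroup_mulE.
by rewrite catA.
Qed.

Lemma pgroup_mul1 : left_id pgroup_one pgroup_mul.
Proof. by move=> a; rewrite -[a]reprK; move: (repr a) => u; rewrite pgroup_mulE. Qed.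

Lemma pgroup_1mul : right_id pgroup_one pgroup_mul.
Proof. by move=> a; rewrite -[a]reprK; move: (repr a) => u; rewrite pgroup_mulE cats0. Qed.

Lemma pgroup_mulV : left_inverse pgroup_one pgroup_inv pgroup_mul.
Proof.
move=> a; rewrite -[a]reprK; move: (repr a) => u; rewrite pgroup_invE pgroup_mulE.
by apply/eqP/pres_eqP; exact: winv_catl.
Qed.

Lemma pgroup_Vmul : right_inverse pgroup_one pgroup_inv pgroup_mul.
Proof.
move=> a; rewrite -[a]reprK; move: (repr a) => u; rewrite pgroup_invE pgroup_mulE.
by apply/eqP/pres_eqP; exact: winv_catr.
Qed.

HB.instance Definition _ := isGroup.Build pgroup pgroup_mulA pgroup_mul1
  pgroup_1mul pgroup_mulV pgroup_Vmul.

Section Lift.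
Variables (G : groupType) (f : X -> G).
Variable frel : forall r, rel r -> weval f r = 1%g.

(* The proof argument makes the morphism instance below inferable. *)
Definition pgroup_lift (_ : forall r, rel r -> weval f r = 1%g) (a : pgroup) :=
  weval f (repr a).

Lemma weval_cat u v : weval f (u ++ v) = (weval f u * weval f v)%g.
Proof. by rewrite /weval big_cat. Qed.

Lemma weval_pres_eq u v : pres_eq u v -> weval f u = weval f v.
Proof.
elim=> {u v} // [u v t _ -> //|u v x b|u v r /frel r1].
  rewrite !weval_cat; congr (_ * _)%g; rewrite -[RHS]mul1g; congr (_ * _)%g.
  rewrite /weval big_cons big_seq1 /=.
  by case: b; rewrite /= ?mulgV ?mulVg.
by rewrite !weval_cat r1 mul1g.
Qed.

Lemma pgroup_liftM : {morph pgroup_lift frel : a b / (a * b)%g}.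
Proof.
move=> a b; rewrite -[a]reprK -[b]reprK; move: (repr a) (repr b) => u v.
rewrite [(_ * _)%g]pgroup_mulE /pgroup_lift -weval_cat.
apply: weval_pres_eq; apply: (@pres_trans _ (u ++ v)).
  by apply/pres_eqP; rewrite reprK.
by apply: pres_eq_cat; apply/pres_eqP; rewrite reprK.
Qed.

HB.instance Definition _ :=
  isMultiplicative.Build pgroup G (pgroup_lift frel) pgroup_liftM.
End Lift.

End PresentedGroup.

(* Relators are an indexed family, so that their number is the cardinality of
   the index type Y even if some of them coincide as words. Restricting X and Y
   to choiceType is no loss, as every type has a (classical) choice structure. *)
Definition presents (X Y : choiceType) (r : Y -> word X) (G : groupType) :=
  exists f : {multiplicative pgroup (range r) -> G}, bijective f.

Definition grank (R : realType) (G : groupType) : \bar R :=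
  ereal_inf [set x | exists (X Y : choiceType) (r : Y -> word X),
    presents r G /\ x = counting [set: X]].

(* The subtraction is the dual one, for which +oo - +oo = +oo: a presentation
   with infinitely many generators and infinitely many relators has no
   meaningful difference |R| - |X| and must not contribute -oo to the infimum. *)
Definition deficiency (R : realType) (G : groupType) : \bar R :=
  ereal_inf [set x | exists (X Y : choiceType) (r : Y -> word X),
    presents r G /\ x = (counting [set: Y] - counting [set: X])%dE].

Section FreeProduct.
Variables (I : choiceType) (G : I -> groupType).

Definition letter (i : I) (g : G i) (b : bool) : {i : I & G i} * bool :=
  (Tagged (fun i => G i : Type) g, b).

(* g * h = gh for g and h in the same factor; the relations 1 = 1_i follow. *)
Definition free_product_rel : set (word {i : I & G i}) :=
  [set w | exists i (g h : G i),
    w = [:: letter g true; letter h true; letter (g * h)%g false]].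

Definition free_product : groupType := pgroup free_product_rel.
End FreeProduct.
Arguments free_product_rel {I} G _.

Definition direct_product (I : Type) (G : I -> groupType) := forall i, G i.

Section DirectProduct.
Variables (I : Type) (G : I -> groupType).
Local Notation P := (direct_product G).

HB.instance Definition _ := Choice.on P.

Definition dp_mul (f g : P) : P := fun i => (f i * g i)%g.
Definition dp_one : P := fun=> 1%g.
Definition dp_inv (f : P) : P := fun i => (f i)^-1%g.

Lemma dp_mulA : associative dp_mul.
Proof. by move=> f g h; apply/functional_extensionality_dep => i; exact: mulgA. Qed.
Lemma dp_mul1 : left_id dp_one dp_mul.
Proof. by move=> f; apply/functional_extensionality_dep => i; exact: mul1g. Qed.
Lemma dp_1mul : right_id dp_one dp_mul.
Proof. by move=> f; apply/functional_extensionality_dep => i; exact: mulg1. Qed.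
Lemma dp_mulV : left_inverse dp_one dp_inv dp_mul.
Proof. by move=> f; apply/functional_extensionality_dep => i; exact: mulVg. Qed.
Lemma dp_Vmul : right_inverse dp_one dp_inv dp_mul.
Proof. by move=> f; apply/functional_extensionality_dep => i; exact: mulgV. Qed.

HB.instance Definition _ :=
  isGroup.Build P dp_mulA dp_mul1 dp_1mul dp_mulV dp_Vmul.

Lemma dp_mulE (f g : P) i : (f * g)%g i = (f i * g i)%g. Proof. by []. Qed.
Lemma dp_invE (f : P) i : (f^-1)%g i = (f i)^-1%g. Proof. by []. Qed.
Lemma dp_oneE i : (1%g : P) i = 1%g. Proof. by []. Qed.
End DirectProduct.

Section Kernel.
Variables (G H : groupType) (f : {multiplicative G -> H}).

Definition in_kernel : pred G := [pred x | f x == 1%g].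

Lemma morph1 : f 1%g = 1%g.
Proof. by apply: (mulgI (f 1%g)); rewrite -gmulfM !mulg1. Qed.

Lemma in_kernel_closed : group_closed in_kernel.
Proof.
split=> [|x y]; rewrite !inE ?morph1// => /eqP fx /eqP fy.
apply/eqP/(mulIg (f y)); rewrite -gmulfM mulgVK.
by rewrite fx fy mulg1.
Qed.

Definition kernel := {x : G | in_kernel x}.

HB.instance Definition _ := SubChoice.on kernel.
HB.instance Definition _ :=
  SubChoice_isSubGroup.Build G in_kernel kernel in_kernel_closed.
End Kernel.

Definition simplicial_complex m (K : {set {set 'I_m}}) : Prop :=
  [/\ finset.set0 \in K, forall i, [set i]%SET \in K
    & forall I J : {set 'I_m}, I \in K -> J \subset I -> J \in K].

Definition flag m (K : {set {set 'I_m}}) : Prop :=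
  forall I : {set 'I_m},
    (forall i j, i \in I -> j \in I -> [set i; j]%SET \in K) -> I \in K.

Definition full_subcomplex m (K : {set {set 'I_m}}) (J : {set 'I_m}) :
    {set {set 'I_m}} :=
  [set I in K | I \subset J]%SET.

Section GraphProduct.
Variables (m : nat) (K : {set {set 'I_m}}) (G : 'I_m -> groupType).

Definition commutation_rel : set (word {i : 'I_m & G i}) :=
  [set w | exists i j (g : G i) (h : G j),
    [/\ i != j, [set i; j]%SET \in K &
      w = [:: letter g true; letter h true; letter g false; letter h false]]].

Definition graph_product : groupType :=
  pgroup (free_product_rel G `|` commutation_rel).

Definition dp_inj (x : {i : 'I_m & G i}) : direct_product G :=
  @eqtype.dfwith _ (fun i => G i : Type) (fun=> 1%g) (tag x) (tagged x).

Lemma dp_inj_rel r : (free_product_rel G `|` commutation_rel) r ->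
  weval dp_inj r = 1%g.
Proof.
case=> [[i [g [h ->]]]|[i [j [g [h [ij _ ->]]]]]];
  rewrite /weval !big_cons big_nil /= /dp_inj /=;
  apply/functional_extensionality_dep => k; rewrite !(dp_mulE, dp_invE, dp_oneE).
  have [ki|ik] := eqVneq i k; last by rewrite !dfwith_out// mulg1 invg1 !mulg1.
  by subst k; rewrite !dfwith_in mulg1 mulgA mulgV.
have [ki|ik] := eqVneq i k.
  subst k; rewrite !dfwith_in !(@dfwith_out _ _ _ j) 1?eq_sym//.
  by rewrite invg1 !mulg1 mul1g mulgV.
rewrite !(@dfwith_out _ _ _ i)// invg1 !mul1g mulg1 mulgV//.
Qed.

Definition graph_product_proj : {multiplicative graph_product -> direct_product G}
  := pgroup_lift dp_inj_rel.

Definition Cart : groupType := kernel graph_product_proj.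
End GraphProduct.

Local Open Scope ring_scope.

Definition unit_itv (R : realType) : Type := set_type `[0%R, 1%R : R]%classic.

Section UnitInterval.
Variable R : realType.
Local Notation I := (unit_itv R).

HB.instance Definition _ := Topological.on I.

Lemma clamp_subproof (t : R) :
  Num.max 0 (Num.min 1 t) \in `[0%R, 1%R : R]%classic.
Proof. by rewrite inE /= in_itv /= le_max lexx ge_max ler01 ge_min lexx. Qed.

Definition clamp (t : R) : I := exist (fun x => x \in _) _ (clamp_subproof t).

Lemma unit_itvP (t : I) : 0 <= \val t <= 1.
Proof. by case: t => t /= /set_mem; rewrite /= in_itv. Qed.

Lemma val_clamp t : 0 <= t <= 1 -> \val (clamp t) = t.
Proof. by move=> /andP[t0 t1] /=; rewrite min_r// max_r. Qed.

Lemma clampK (t : I) : clamp (\val t) = t.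
Proof. by apply/val_inj; rewrite val_clamp// unit_itvP. Qed.

Lemma clamp0_neq1 : clamp 0 != clamp 1.
Proof.
apply/eqP => /(congr1 \val); rewrite !val_clamp ?lexx ?ler01//.
by apply/eqP; rewrite eq_sym oner_eq0.
Qed.

HB.instance Definition _ := isBiPointed.Build I clamp0_neq1.

Lemma val_zero : \val (zero : I) = 0.
Proof. by rewrite val_clamp// lexx ler01. Qed.
Lemma val_one : \val (one : I) = 1.
Proof. by rewrite val_clamp// lexx ler01. Qed.

Lemma val_continuous : continuous (\val : I -> R).
Proof. exact: initial_continuous. Qed.

Lemma clamp_continuous : continuous clamp.
Proof.
apply: continuous_comp_initial => t.
have : {for t, continuous (fun t : R => Num.max 0 (Num.min 1 t))}.
  apply: continuous_max; first exact: cvg_cst.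
  by apply: continuous_min; [exact: cvg_cst|exact: cvg_id].
exact.
Qed.

Lemma clamp_le0 t : t <= 0 -> clamp t = zero.
Proof.
move=> t0; apply/val_inj; rewrite val_zero /=.
by apply/max_idPl; rewrite ge_min t0 orbT.
Qed.
Lemma clamp_ge1 t : 1 <= t -> clamp t = one.
Proof.
by move=> t0; apply/val_inj; rewrite val_one /= min_l// max_r.
Qed.

End UnitInterval.

Section RealValued.
Variables (R : realType) (X : topologicalType).
Implicit Types f g : X -> R.

Lemma ctsD f g : continuous f -> continuous g -> continuous (fun x => f x + g x).
Proof. by move=> cf cg x; apply: (@cvgD R R^o); [exact: cf|exact: cg]. Qed.
Lemma ctsB f g : continuous f -> continuous g -> continuous (fun x => f x - g x).
Proof. by move=> cf cg x; apply: (@cvgB R R^o); [exact: cf|exact: cg]. Qed.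
Lemma ctsM f g : continuous f -> continuous g -> continuous (fun x => f x * g x).
Proof. by move=> cf cg x; apply: (@cvgM R); [exact: cf|exact: cg]. Qed.
Lemma ctsC (c : R) : continuous (fun _ : X => c).
Proof. by move=> x; exact: cvg_cst. Qed.
End RealValued.

Lemma fst_continuous (A B : topologicalType) : continuous (@fst A B).
Proof. by move=> x; exact: cvg_fst. Qed.
Lemma snd_continuous (A B : topologicalType) : continuous (@snd A B).
Proof. by move=> x; exact: cvg_snd. Qed.

Lemma cts_comp (A B C : topologicalType) (f : A -> B) (g : B -> C) :
  continuous f -> continuous g -> continuous (fun a => g (f a)).
Proof. by move=> cf cg a; apply: continuous_comp; [exact: cf|exact: cg]. Qed.

Section paste.
Variables (R : realType) (X T : topologicalType) (h : X -> R) (f g : X -> T) (c : R).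

Lemma paste_continuous : continuous h -> continuous f -> continuous g ->
  (forall x, h x = c -> f x = g x) ->
  continuous (fun x => if h x <= c then f x else g x).
Proof.
move=> ch cf cg fg.
set k := (X in continuous X).
have : {within [set x | h x <= c] `|` [set x | c <= h x], continuous k}.
  apply: withinU_continuous.
  - by apply: (@closed_comp _ _ h [set y | y <= c]); [move=> *; exact: ch|exact: closed_le].
  - by apply: (@closed_comp _ _ h [set y | c <= y]); [move=> *; exact: ch|exact: closed_ge].
  - apply: (@subspace_eq_continuous _ _ _ f).
      by move=> x /set_mem /= xc; rewrite /from_subspace /k xc.
    exact: continuous_subspaceT.
  - apply: (@subspace_eq_continuous _ _ _ g).
      move=> x /set_mem /= cx; rewrite /from_subspace /k; case: ifPn => // xc.
      by apply/esym/fg/le_anti; rewrite cx xc.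
    exact: continuous_subspaceT.
have -> : [set x | h x <= c] `|` [set x | c <= h x] = setT.
  by apply/seteqP; split=> x //= _; apply/orP; exact: le_total.
by move=> kk; apply/continuous_subspace_setT.
Qed.
End paste.

Section FundamentalGroup.
Variables (R : realType) (T : topologicalType) (x : T).
Local Notation I := (unit_itv R).
Local Notation loop := {path I from x to x in T}.

(* Homotopy relative to the end points. *)
Definition homotopic (p q : I -> T) := exists H : I * I -> T,
  [/\ continuous H, forall t, H (zero, t) = p t, forall t, H (one, t) = q t,
      forall s, H (s, zero) = x & forall s, H (s, one) = x].

Definition concat (p q : I -> T) (t : I) : T :=
  if \val t <= 2^-1 then p (clamp (2 * \val t)) else q (clamp (2 * \val t - 1)).

Definition revpath (p : I -> T) (t : I) : T := p (clamp (1 - \val t)).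

Lemma homotopic_refl (p : loop) : homotopic p p.
Proof.
exists (p \o snd); split=> //=.
- move=> st; apply: continuous_comp; first exact: snd_continuous.
  exact: cts_fun.
- by move=> _; rewrite path_zero.
- by move=> _; rewrite path_one.
Qed.

Lemma cts_rev : continuous (fun t : I => clamp (1 - \val t)).
Proof.
by apply: cts_comp (@clamp_continuous R); apply: ctsB;
  [exact: ctsC|exact: val_continuous].
Qed.

Lemma cts_mapl (f : I -> I) : continuous f ->
  continuous (fun st : I * I => (f st.1, st.2)).
Proof.
move=> cf st; apply: (@cvg_pair _ _ _ (nbhs st) (nbhs (f st.1)) (nbhs st.2));
  last exact: snd_continuous.
by apply: (@continuous_comp _ _ _ fst); [exact: fst_continuous|exact: cf].
Qed.

Lemma cts_mapr (f : I -> I) : continuous f ->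
  continuous (fun st : I * I => (st.1, f st.2)).
Proof.
move=> cf st; apply: (@cvg_pair _ _ _ (nbhs st) (nbhs st.1) (nbhs (f st.2)));
  first exact: fst_continuous.
by apply: (@continuous_comp _ _ _ snd); [exact: snd_continuous|exact: cf].
Qed.

Lemma homotopic_sym p q : homotopic p q -> homotopic q p.
Proof.
move=> [H [cH Hp Hq H0 H1]].
exists (fun st => H (clamp (1 - \val st.1), st.2)); split; cbn [fst snd comp].
- exact: (cts_comp (cts_mapl cts_rev) cH).
- by move=> t; rewrite val_zero subr0 clamp_ge1.
- by move=> t; rewrite val_one subrr clamp_le0.
- by move=> s; exact: H0.
- by move=> s; exact: H1.
Qed.

Lemma cts_half1 : continuous (fun t : I => clamp (2 * \val t)).
Proof.
by apply: cts_comp (@clamp_continuous R); apply: ctsM;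
  [exact: ctsC|exact: val_continuous].
Qed.

Lemma cts_half2 : continuous (fun t : I => clamp (2 * \val t - 1)).
Proof.
apply: cts_comp (@clamp_continuous R); apply: ctsB; last exact: ctsC.
by apply: ctsM; [exact: ctsC|exact: val_continuous].
Qed.

Lemma half_le1 (t : R) : t <= 2^-1 -> 2 * t <= 1.
Proof. by move=> h; lra. Qed.

Lemma homotopic_trans p q r : homotopic p q -> homotopic q r -> homotopic p r.
Proof.
move=> [H [cH Hp Hq H0 H1]] [K [cK Kq Kr K0 K1]].
exists (fun st => if \val st.1 <= 2^-1 then H (clamp (2 * \val st.1), st.2)
                  else K (clamp (2 * \val st.1 - 1), st.2)); split; cbn [fst snd].
- apply: (@paste_continuous R _ _ (fun st : I * I => \val st.1)
    (fun st => H (clamp (2 * \val st.1), st.2))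
    (fun st => K (clamp (2 * \val st.1 - 1), st.2))).
  + exact: (cts_comp (@fst_continuous _ _) (@val_continuous R)).
  + exact: (cts_comp (cts_mapl cts_half1) cH).
  + exact: (cts_comp (cts_mapl cts_half2) cK).
  + move=> [s t] /= ->; rewrite mulfV ?pnatr_eq0// subrr clamp_ge1// clamp_le0//.
    by rewrite Hq Kq.
- by move=> t; rewrite val_zero invr_ge0 ler0n mulr0 clamp_le0.
- move=> t; rewrite val_one ifF ?clamp_ge1//; first by rewrite mulr1; lra.
  by apply/negbTE; rewrite -ltNge invf_lt1// ltr1n.
- by move=> s; rewrite H0 K0 if_same.
- by move=> s; rewrite H1 K1 if_same.
Qed.

Lemma concat_continuous (p q : loop) : continuous (concat p q).
Proof.
apply: (@paste_continuous R _ _ (\val : I -> R) (fun t => p (clamp (2 * \val t)))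
  (fun t => q (clamp (2 * \val t - 1)))).
- exact: val_continuous.
- exact: (cts_comp cts_half1 (@cts_fun _ _ p)).
- exact: (cts_comp cts_half2 (@cts_fun _ _ q)).
- move=> t ->; rewrite mulfV ?pnatr_eq0// subrr clamp_ge1// clamp_le0//.
  by rewrite path_zero path_one.
Qed.

Lemma concat_zero (p q : loop) : concat p q zero = x.
Proof.
by rewrite /concat val_zero invr_ge0 ler0n mulr0 clamp_le0// path_zero.
Qed.

Lemma concat_one (p q : loop) : concat p q one = x.
Proof.
rewrite /concat val_one ifF; first by rewrite clamp_ge1 ?path_one// mulr1; lra.
by apply/negbTE; rewrite -ltNge invf_lt1// ltr1n.
Qed.

Definition concat_loop (p q : loop) : loop :=
  mk_path (@concat_continuous p q) (concat_zero p q) (concat_one p q).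

Lemma revpath_continuous (p : loop) : continuous (revpath p).
Proof. exact: (cts_comp cts_rev (@cts_fun _ _ p)). Qed.

Lemma revpath_zero (p : loop) : revpath p zero = x.
Proof. by rewrite /revpath val_zero subr0 clamp_ge1// path_one. Qed.

Lemma revpath_one (p : loop) : revpath p one = x.
Proof. by rewrite /revpath val_one subrr clamp_le0// path_zero. Qed.

Definition rev_loop (p : loop) : loop :=
  mk_path (@revpath_continuous p) (revpath_zero p) (revpath_one p).

Definition const_loop : loop := (cst x : I -> T).

Lemma homotopic_concat p p' q q' :
  homotopic p p' -> homotopic q q' -> homotopic (concat p q) (concat p' q').
Proof.
move=> [H [cH Hp Hq H0 H1]] [K [cK Kq Kr K0 K1]].
exists (fun st => if \val st.2 <= 2^-1 then H (st.1, clamp (2 * \val st.2))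
                  else K (st.1, clamp (2 * \val st.2 - 1))); split; cbn [fst snd].
- apply: (@paste_continuous R _ _ (fun st : I * I => \val st.2)
    (fun st => H (st.1, clamp (2 * \val st.2)))
    (fun st => K (st.1, clamp (2 * \val st.2 - 1)))).
  + exact: (cts_comp (@snd_continuous _ _) (@val_continuous R)).
  + exact: (cts_comp (cts_mapr cts_half1) cH).
  + exact: (cts_comp (cts_mapr cts_half2) cK).
  + move=> [s t] /= ->; rewrite mulfV ?pnatr_eq0// subrr clamp_ge1// clamp_le0//.
    by rewrite H1 K0.
- by move=> t; rewrite Hp Kq.
- by move=> t; rewrite Hq Kr.
- by move=> s; rewrite val_zero invr_ge0 ler0n mulr0 clamp_le0.
- move=> s; rewrite val_one ifF ?clamp_ge1//; first by rewrite mulr1; lra.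
  by apply/negbTE; rewrite -ltNge invf_lt1// ltr1n.
Qed.

Lemma homotopic_rev p q : homotopic p q -> homotopic (revpath p) (revpath q).
Proof.
move=> [H [cH Hp Hq H0 H1]].
exists (fun st => H (st.1, clamp (1 - \val st.2))); split; cbn [fst snd].
- exact: (cts_comp (cts_mapr cts_rev) cH).
- by move=> t; rewrite Hp.
- by move=> t; rewrite Hq.
- by move=> s; rewrite val_zero subr0 clamp_ge1.
- by move=> s; rewrite val_one subrr clamp_le0.
Qed.

(* Two reparametrizations of one path in T, by functions with the same end
   values, are homotopic. *)
Lemma homotopic_reparam (P : R -> T) (phi psi : I -> R) :
  continuous P -> continuous phi -> continuous psi ->
  phi zero = psi zero -> phi one = psi one ->
  P (phi zero) = x -> P (phi one) = x ->
  homotopic (P \o phi) (P \o psi).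
Proof.
move=> cP cphi cpsi e0 e1 P0 P1.
exists (fun st => P ((1 - \val st.1) * phi st.2 + \val st.1 * psi st.2)); split; cbn [fst snd].
- have c1 : continuous (fun st : I * I => \val st.1).
    exact: (cts_comp (@fst_continuous _ _) (@val_continuous R)).
  have cs (f : I -> R) : continuous f -> continuous (fun st : I * I => f st.2).
    by move=> cf; apply: (@cts_comp _ _ _ snd f); [exact: snd_continuous|exact: cf].
  apply: (@cts_comp _ _ _ (fun st : I * I =>
    (1 - \val st.1) * phi st.2 + \val st.1 * psi st.2) P) => //.
  apply: ctsD; apply: ctsM; [|exact: cs|exact: c1|exact: cs].
  by apply: ctsB; [exact: ctsC|exact: c1].
- by move=> t; rewrite val_zero subr0 mul1r mul0r addr0.
- by move=> t; rewrite val_one subrr mul0r mul1r add0r.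
- by move=> s; rewrite -e0 -mulrDl subrK mul1r.
- by move=> s; rewrite -e1 -mulrDl subrK mul1r.
Qed.

Lemma homotopic_ext p p' q q' : p =1 p' -> q =1 q' ->
  homotopic p q -> homotopic p' q'.
Proof.
move=> pp' qq' [H [cH Hp Hq H0 H1]]; exists H; split=> // t.
  by rewrite Hp.
by rewrite Hq.
Qed.

Lemma extend_continuous (p : loop) : continuous (fun t : R => p (clamp t)).
Proof. exact: (cts_comp (@clamp_continuous R) (@cts_fun _ _ p)). Qed.

Lemma concat_assoc (p q r : loop) :
  homotopic (concat p (concat q r)) (concat (concat p q) r).
Proof.
pose P (u : R) := if u <= 1 then p (clamp u)
  else if u <= 2 then q (clamp (u - 1)) else r (clamp (u - 2)).
have cP : continuous P.
  have csub (c : R) : continuous (fun u : R => u - c).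
    by apply: ctsB; [move=> u; exact: cvg_id|exact: ctsC].
  apply: (@paste_continuous R _ _ (fun u : R => u)).
  - by move=> u; exact: cvg_id.
  - exact: extend_continuous.
  - apply: (@paste_continuous R _ _ (fun u : R => u)).
    + by move=> u; exact: cvg_id.
    + exact: (cts_comp (csub 1) (@extend_continuous q)).
    + exact: (cts_comp (csub 2) (@extend_continuous r)).
    + move=> _ ->; rewrite clamp_ge1; last by lra.
      by rewrite clamp_le0 ?path_one ?path_zero//; lra.
  - move=> _ ->; rewrite ler1n /= clamp_ge1// clamp_le0 ?subrr//.
    by rewrite path_one path_zero.
pose phi (t : I) : R := if \val t <= 2^-1 then 2 * \val t else 4 * \val t - 1.
pose psi (t : I) : R := if \val t <= 2^-1 then 4 * \val t else 2 * \val t + 1.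
have caff (a b : R) : continuous (fun t : I => a * \val t + b).
  apply: ctsD; last exact: ctsC.
  by apply: ctsM; [exact: ctsC|exact: val_continuous].
have cphi : continuous phi.
  apply: (@paste_continuous R _ _ (\val : I -> R) (fun t => 2 * \val t)).
  - exact: val_continuous.
  - by apply: ctsM; [exact: ctsC|exact: val_continuous].
  - exact: caff.
  - by move=> t ->; lra.
have cpsi : continuous psi.
  apply: (@paste_continuous R _ _ (\val : I -> R) (fun t => 4 * \val t)).
  - exact: val_continuous.
  - by apply: ctsM; [exact: ctsC|exact: val_continuous].
  - exact: caff.
  - by move=> t ->; lra.
have half1 : (1 <= 2^-1 :> R) = false by apply/negbTE; rewrite -ltNge; lra.
have half0 : (0 <= 2^-1 :> R) by lra.
have phi0 : phi zero = 0 by rewrite /phi val_zero half0 mulr0.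
have psi0 : psi zero = 0 by rewrite /psi val_zero half0 mulr0.
have phi1 : phi one = 3 by rewrite /phi val_one half1; lra.
have psi1 : psi one = 3 by rewrite /psi val_one half1; lra.
apply: (@homotopic_ext (P \o phi) _ (P \o psi)); last first.
- apply: homotopic_reparam => //; rewrite ?phi0 ?phi1 ?psi0 ?psi1//.
    by rewrite /P ler01 clamp_le0// path_zero.
  rewrite /P ifF; last by apply/negbTE; rewrite -ltNge; lra.
  rewrite ifF; last by apply/negbTE; rewrite -ltNge; lra.
  by rewrite clamp_ge1 ?path_one//; lra.
- move=> t; rewrite /P /phi /psi /concat /comp.
  have /andP[t0 t1] := unit_itvP t.
  have [h|h] := leP (\val t) 2^-1; last first.
    rewrite ifF; last by apply/negbTE; rewrite -ltNge; lra.
    rewrite ifF; last by apply/negbTE; rewrite -ltNge; lra.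
    by congr (r (clamp _)); lra.
  rewrite val_clamp; last by lra.
  have [k|k] := leP (4 * \val t) 1.
    by rewrite ifT; [congr (p (clamp _)); lra|lra].
  rewrite ifT; last by lra.
  rewrite ifF; last by apply/negbTE; rewrite -ltNge; lra.
  by congr (q (clamp _)); lra.
- move=> t; rewrite /P /phi /psi /concat /comp.
  have /andP[t0 t1] := unit_itvP t.
  have [h|h] := leP (\val t) 2^-1; first by rewrite ifT//; lra.
  rewrite ifF; last by apply/negbTE; rewrite -ltNge; lra.
  rewrite val_clamp; last by lra.
  have [k|k] := leP (2 * \val t - 1) 2^-1.
    by rewrite ifT; [congr (q (clamp _)); lra|lra].
  rewrite ifF; last by apply/negbTE; rewrite -ltNge; lra.
  by congr (r (clamp _)); lra.
Qed.

Lemma cts_affine_paste (a b c d : R) : a / 2 + b = c / 2 + d ->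
  continuous (fun t : I => if \val t <= 2^-1 then a * \val t + b
                           else c * \val t + d).
Proof.
move=> abcd.
have caff (u v : R) : continuous (fun t : I => u * \val t + v).
  apply: ctsD; last exact: ctsC.
  by apply: ctsM; [exact: ctsC|exact: val_continuous].
apply: (@paste_continuous R _ _ (\val : I -> R) (fun t => a * \val t + b)).
- exact: val_continuous.
- exact: caff.
- exact: caff.
- by move=> t ->.
Qed.

Lemma reparam_loop (p : loop) (a b c d a' b' c' d' : R) (f g : I -> T) :
  a / 2 + b = c / 2 + d -> a' / 2 + b' = c' / 2 + d' ->
  b = b' -> c + d = c' + d' ->
  p (clamp b) = x -> p (clamp (c + d)) = x ->
  (forall t : I, f t = p (clamp (if \val t <= 2^-1 then a * \val t + b
                                 else c * \val t + d))) ->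
  (forall t : I, g t = p (clamp (if \val t <= 2^-1 then a' * \val t + b'
                                 else c' * \val t + d'))) ->
  homotopic f g.
Proof.
move=> e e' bb' cd pb pcd fE gE.
pose phi (t : I) : R := if \val t <= 2^-1 then a * \val t + b
                        else c * \val t + d.
pose psi (t : I) : R := if \val t <= 2^-1 then a' * \val t + b'
                        else c' * \val t + d'.
have half1 : (1 <= 2^-1 :> R) = false by apply/negbTE; rewrite -ltNge; lra.
have half0 : (0 <= 2^-1 :> R) by lra.
have phi0 : phi zero = b by rewrite /phi val_zero half0 mulr0 add0r.
have psi0 : psi zero = b by rewrite /psi val_zero half0 mulr0 add0r.
have phi1 : phi one = c + d by rewrite /phi val_one half1 mulr1.
have psi1 : psi one = c + d by rewrite /psi val_one half1 mulr1.
apply: (@homotopic_ext ((fun u => p (clamp u)) \o phi) _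
                       ((fun u => p (clamp u)) \o psi)).
- by move=> t; rewrite fE.
- by move=> t; rewrite gE.
- apply: homotopic_reparam; rewrite ?phi0 ?phi1 ?psi0 ?psi1//.
  + exact: extend_continuous.
  + exact: cts_affine_paste.
  + exact: cts_affine_paste.
Qed.

Lemma loop_clamp0 (p : loop) (u : R) : u <= 0 -> p (clamp u) = x.
Proof. by move=> ?; rewrite clamp_le0// path_zero. Qed.
Lemma loop_clamp1 (p : loop) (u : R) : 1 <= u -> p (clamp u) = x.
Proof. by move=> ?; rewrite clamp_ge1// path_one. Qed.

Lemma concat_const_l (p : loop) : homotopic (concat const_loop p) p.
Proof.
apply: (@reparam_loop p 0 0 2 (-1) 1 0 1 0); [lra|lra|lra|lra| | | |].
- by rewrite (loop_clamp0 p).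
- by rewrite (loop_clamp1 p)//; lra.
- move=> t; rewrite /concat; case: ifP => // _.
  by rewrite (loop_clamp0 p)//; lra.
- move=> t; rewrite if_same; have -> : 1 * \val t + 0 = \val t by lra.
  by rewrite clampK.
Qed.

Lemma concat_const_r (p : loop) : homotopic (concat p const_loop) p.
Proof.
apply: (@reparam_loop p 2 0 0 1 1 0 1 0); [lra|lra|lra|lra| | | |].
- by rewrite (loop_clamp0 p).
- by rewrite (loop_clamp1 p)//; lra.
- move=> t; rewrite /concat; case: ifP => // _; first by rewrite addr0.
  by rewrite (loop_clamp1 p)//; lra.
- move=> t; rewrite if_same; have -> : 1 * \val t + 0 = \val t by lra.
  by rewrite clampK.
Qed.

Lemma concat_rev_l (p : loop) : homotopic (concat (revpath p) p) const_loop.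
Proof.
apply: (@reparam_loop p (-2) 1 2 (-1) 0 1 0 1); [lra|lra|lra|lra| | | |].
- by rewrite (loop_clamp1 p).
- by rewrite (loop_clamp1 p)//; lra.
- move=> t; rewrite /concat /revpath; case: ifP => // h.
  have /andP[t0 t1] := unit_itvP t.
  by rewrite val_clamp; [congr (p (clamp _)); lra|lra].
- by move=> t; rewrite if_same (loop_clamp1 p)//; lra.
Qed.

Lemma concat_rev_r (p : loop) : homotopic (concat p (revpath p)) const_loop.
Proof.
apply: (@reparam_loop p 2 0 (-2) 2 0 0 0 0); [lra|lra|lra|lra| | | |].
- by rewrite (loop_clamp0 p).
- by rewrite (loop_clamp0 p)//; lra.
- move=> t; rewrite /concat /revpath; case: ifP => h; first by rewrite addr0.
  have /andP[t0 t1] := unit_itvP t.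
  have : 2^-1 < \val t by rewrite ltNge h.
  by move=> h'; rewrite val_clamp; [congr (p (clamp _)); lra|lra].
- by move=> t; rewrite if_same (loop_clamp0 p)//; lra.
Qed.

Definition loop_eqb : ssrbool.rel loop := fun p q => `[< homotopic p q >].

Lemma loop_eqb_refl : reflexive loop_eqb.
Proof. by move=> p; apply/asboolP; exact: homotopic_refl. Qed.
Lemma loop_eqb_sym : ssrbool.symmetric loop_eqb.
Proof. by move=> p q; apply/asboolP/asboolP => /homotopic_sym. Qed.
Lemma loop_eqb_trans : ssrbool.transitive loop_eqb.
Proof.
by move=> q p r /asboolP pq /asboolP qr; apply/asboolP; exact: homotopic_trans qr.
Qed.

Canonical loop_equiv := EquivRel loop_eqb loop_eqb_refl loop_eqb_sym
  loop_eqb_trans.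

Definition pi1 := {eq_quot loop_equiv}.

HB.instance Definition _ := Choice.on pi1.
HB.instance Definition _ := EqQuotient.on pi1.

Lemma homotopicP (p q : loop) :
  reflect (homotopic p q) (\pi_pi1 p == \pi_pi1 q).
Proof. by rewrite piE; exact: asboolP. Qed.

Lemma homotopic_repr (p : loop) : homotopic (repr (\pi_pi1 p)) p.
Proof. by apply/homotopicP; rewrite reprK. Qed.

Definition pi1_one : pi1 := \pi_pi1 const_loop.
Definition pi1_mul (a b : pi1) : pi1 := \pi_pi1 (concat_loop (repr a) (repr b)).
Definition pi1_inv (a : pi1) : pi1 := \pi_pi1 (rev_loop (repr a)).

Lemma pi1_mulA : associative pi1_mul.
Proof.
move=> a b c; apply/eqP/homotopicP.
apply: (@homotopic_trans _ (concat (repr a) (concat (repr b) (repr c)))).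
  by apply: homotopic_concat; [exact: homotopic_refl|exact: homotopic_repr].
apply: (homotopic_trans (concat_assoc _ _ _)).
apply: homotopic_concat; last exact: homotopic_refl.
exact/homotopic_sym/homotopic_repr.
Qed.

Lemma pi1_mul1 : left_id pi1_one pi1_mul.
Proof.
move=> a; rewrite -[RHS]reprK; apply/eqP/homotopicP.
apply: homotopic_trans (concat_const_l (repr a)).
by apply: homotopic_concat; [exact: homotopic_repr|exact: homotopic_refl].
Qed.

Lemma pi1_1mul : right_id pi1_one pi1_mul.
Proof.
move=> a; rewrite -[RHS]reprK; apply/eqP/homotopicP.
apply: homotopic_trans (concat_const_r (repr a)).
by apply: homotopic_concat; [exact: homotopic_refl|exact: homotopic_repr].
Qed.

Lemma pi1_mulV : left_inverse pi1_one pi1_inv pi1_mul.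
Proof.
move=> a; apply/eqP/homotopicP.
apply: homotopic_trans (concat_rev_l (repr a)).
by apply: homotopic_concat; [exact: homotopic_repr|exact: homotopic_refl].
Qed.

Lemma pi1_Vmul : right_inverse pi1_one pi1_inv pi1_mul.
Proof.
move=> a; apply/eqP/homotopicP.
apply: homotopic_trans (concat_rev_r (repr a)).
by apply: homotopic_concat; [exact: homotopic_refl|exact: homotopic_repr].
Qed.

HB.instance Definition _ := isGroup.Build pi1 pi1_mulA pi1_mul1
  pi1_1mul pi1_mulV pi1_Vmul.

End FundamentalGroup.

Section PathComponents.
Variables (R : realType) (T : topologicalType).

Definition path_component (x : T) : set T :=
  [set y | $| {path unit_itv R from x to y in T} |].

Definition path_components := {C : set T | `[< exists x, C = path_component x >]}.

Lemma path_component_refl (x : T) : path_component x x.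
Proof. by squash (cst x : unit_itv R -> T). Qed.

Lemma path_component_nonempty (C : path_components) : exists x : \val C, True.
Proof.
case: C => C /= /asboolP[x ->].
by exists (exist (fun y => y \in path_component x) x (mem_set (path_component_refl x))).
Qed.

Definition base_point (C : path_components) : \val C :=
  sval (cid (path_component_nonempty C)).

(* The free product of the groups pi_1(C) over the path components C of T. *)
Definition Pi1 : groupType :=
  free_product (fun C : path_components => pi1 R (base_point C)).

End PathComponents.

(* B is a family of representatives, one for each vector, of a basis of V / W
   (W a subspace of V). *)
Definition quotient_basis (F : fieldType) (E : lmodType F) (V W B : set E) :=
  [/\ B `<=` V,
      forall v, V v -> exists n (a : 'I_n -> F) (b : 'I_n -> E),
        (forall i, B (b i)) /\ W (v - \sum_i a i *: b i) &
      forall n (a : 'I_n -> F) (b : 'I_n -> E), (forall i, B (b i)) ->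
        injective b -> W (\sum_i a i *: b i) -> forall i, a i = 0].

Definition quotient_dim (R : realType) (F : fieldType) (E : lmodType F)
    (V W : set E) : \bar R :=
  ereal_inf [set counting B | B in quotient_basis V W].

Section ReducedBetti0.
Variables (R : realType) (T : topologicalType).

Definition point_chain (x : T) : T -> rat^o := fun y => (y == x)%:R.

(* Kernel of the augmentation on the finitely supported functions T -> Q, i.e.
   on the singular 0-chains of T. *)
Definition reduced_cycles0 : set (T -> rat^o) :=
  [set c | finite_set [set x | c x != 0] /\ \sum_(x \in [set: T]) c x = 0].

(* Boundaries of singular 1-chains, the 1-simplex being [0, 1]. *)
Definition boundaries0 : set (T -> rat^o) :=
  [set c | exists n (a : 'I_n -> rat) (s : 'I_n -> continuousType (unit_itv R) T),
    c = \sum_i a i *: (point_chain (s i one) - point_chain (s i zero))].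

Definition reduced_betti0 : \bar R := quotient_dim R reduced_cycles0 boundaries0.
End ReducedBetti0.

Definition realization (R : realType) m (K : {set {set 'I_m}}) : set 'rV[R]_m :=
  [set x | [/\ forall i, 0 <= x ord0 i, \sum_i x ord0 i = 1 &
               [set i | x ord0 i != 0]%SET \in K]].

Arguments realization R {m} K _.

Section Numbers.
Variables (R : realType) (m : nat) (K : {set {set 'I_m}}) (G : 'I_m -> groupType).
Implicit Types J : {set 'I_m}.

Definition full_realization J : topologicalType :=
  set_type (realization R (full_subcomplex K J)).

Definition b0 J : \bar R := reduced_betti0 R (full_realization J).
Definition rk J : \bar R := grank R (Pi1 R (full_realization J)).

(* As a number, possibly +oo; n_ finset.set0 = 1 and 0 * +oo = 0. *)
Definition n_ J : \bar R :=
  (\prod_(j in J) counting [set g : G j | g != 1%g])%E.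

Definition N_ : \bar R := (\sum_(J : {set 'I_m}) n_ J * b0 J)%E.
Definition Mplus_ : \bar R := (\sum_(J : {set 'I_m}) n_ J * rk J)%E.

(* The same numbers as cardinals, which for infinite groups is finer than their
   values in \bar R: n_type J has cardinality n_J, below x has cardinality x,
   generators and relators have cardinality N and M^+. *)
Definition n_type J := forall j : {j | j \in J}, {g : G (\val j) | g != 1%g}.

Definition below (x : \bar R) := {k : nat | (k%:R%:E < x)%E}.

Definition generators : choiceType := {J : {set 'I_m} & (n_type J * below (b0 J))%type}.
Definition relators : choiceType := {J : {set 'I_m} & (n_type J * below (rk J))%type}.
End Numbers.

(* Main.v *)
(* Let P be the product of the G_i, let supp p be the set of i with p_i <> 1, and
   let erase p i be p with the i-th coordinate replaced by 1. Cart(G,K) is the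
   vertex group at 1 of the groupoid on P generated by the arrows
   p -> erase p i (i in supp p), with one commuting square
     p -> erase p i -> erase (erase p i) j  =  p -> erase p j -> erase (erase p j) i
   for each edge {i,j} of K: an arrow changing the i-th coordinate from g to h
   factors through 1, which takes care of the multiplication in G_i.
   Attach the vertices p by increasing support. With J = supp p, the squares at p
   say that the arrows out of p differ by the paths
     erase p i -> erase (erase p i) j <- erase p j,
   and by the squares lower down these paths depend functorially on the edge
   {i,j} of K_J, a triangle of K_J giving a 3-cube. Hence one arrow per component
   of K_J determines the others; one of these arrows goes into a spanning tree,
   which leaves b~_0(K_J) generators, and the squares at p amount to the triviality
   of the induced homomorphism on Pi_1(K_J), which is a condition on a generating
   set of Pi_1(K_J). Summing over p gives the presentation.
   The topological and the combinatorial Pi_1 are compared only through the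
   holonomy of functors on the edges of K_J. *)
From HB Require Import structures.
Require Import Defs.
From mathcomp Require Import all_boot all_order all_algebra finmap.
From mathcomp Require Import all_classical all_reals all_analysis.
From mathcomp Require Import generic_quotient homotopy lra.

Set Implicit Arguments.
Unset Strict Implicit.
Unset Printing Implicit Defensive.
Import Order.TTheory GRing.Theory Num.Theory.
Import numFieldNormedType.Exports.

(** * Words and presented groups *)

Section WordEval.
Variables (X : choiceType) (G : groupType).
Implicit Types (f : X -> G) (u v w : word X).
Local Open Scope group_scope.

Lemma weval_nil f : weval f [::] = 1.
Proof. by rewrite /weval big_nil. Qed.

Lemma weval_cons f l w :
  weval f (l :: w) = (if l.2 then f l.1 else (f l.1)^-1) * weval f w.
Proof. by rewrite /weval big_cons. Qed.

Lemma weval_winv f w : weval f (winv w) = (weval f w)^-1.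
Proof.
elim: w => [|[x b] w IHw]; first by rewrite weval_nil invg1.
rewrite /winv /= rev_cons -cats1 weval_cat IHw !weval_cons /= weval_nil mulg1.
by rewrite invgM; congr (_ * _); case: b; rewrite ?invgK.
Qed.

Lemma eq_weval f g w : (forall x b, (x, b) \in w -> f x = g x) -> weval f w = weval g w.
Proof.
move=> fg; rewrite /weval big_seq [RHS]big_seq.
by apply: eq_bigr => -[x b] /fg /= ->.
Qed.
End WordEval.

Section Morphisms.
Variables (G H : groupType) (g : {multiplicative G -> H}).
Local Open Scope group_scope.

Lemma morphV (x : G) : g (x^-1) = (g x)^-1.
Proof. by apply: (mulgI (g x)); rewrite -gmulfM !mulgV morph1. Qed.

Lemma weval_morph (X : choiceType) (f : X -> G) w :
  g (weval f w) = weval (g \o f) w.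
Proof.
elim: w => [|[x b] w IHw]; first by rewrite !weval_nil morph1.
by rewrite !weval_cons gmulfM IHw /=; case: b; rewrite ?morphV.
Qed.
End Morphisms.

Section PresentationClass.
Variables (X : choiceType) (rel : set (word X)).
Local Open Scope group_scope.
Local Open Scope quotient_scope.

Definition wclass (w : word X) : pgroup rel := \pi_(pgroup rel) w.

Lemma wclass_cat u v : wclass (u ++ v) = wclass u * wclass v.
Proof. by rewrite [RHS]pgroup_mulE. Qed.

Lemma wclass_nil : wclass [::] = 1.
Proof. by []. Qed.

Lemma wclass_winv w : wclass (winv w) = (wclass w)^-1.
Proof. by rewrite [RHS]pgroup_invE. Qed.

Lemma wclassP (a : pgroup rel) : exists w, a = wclass w.
Proof. by exists (repr a); rewrite /wclass reprK. Qed.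

Lemma wclass_eq u v : wclass u = wclass v <-> pres_eq rel u v.
Proof. by split=> [/eqP/pres_eqP//|/pres_eqP/eqP]. Qed.

Lemma wclass_rel r : rel r -> wclass r = 1.
Proof. by move=> rr; apply/wclass_eq; have := pres_rel [::] [::] rr; rewrite /= cats0. Qed.

Lemma wclass_weval w : wclass w = weval (fun x => wclass [:: (x, true)]) w.
Proof.
elim: w => [|[x b] w IHw]; first by rewrite weval_nil.
rewrite weval_cons -IHw -cat1s wclass_cat; congr (_ * _); case: b => //=.
by rewrite -wclass_winv.
Qed.

Lemma wclass_lift (G : groupType) (f : X -> G)
    (frel : forall r, rel r -> weval f r = 1) w :
  pgroup_lift frel (wclass w) = weval f w.
Proof.
apply: (weval_pres_eq frel); apply/wclass_eq.
by rewrite /wclass reprK.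
Qed.
End PresentationClass.

Section PathProduct.
Variables (V : eqType).
Local Open Scope group_scope.

Section Group.
Variables (G : groupType) (t : V -> V -> G).

Fixpoint path_prod a (s : seq V) : G :=
  if s is b :: s' then t a b * path_prod b s' else 1.

Definition loop_prod (s : seq V) : G :=
  if s is a :: s' then path_prod a s' else 1.

Lemma path_prod_cat a s s' :
  path_prod a (s ++ s') = path_prod a s * path_prod (last a s) s'.
Proof. by elim: s a => [|b s IHs] a /=; rewrite ?mul1g // IHs mulgA. Qed.
End Group.

Section Words.
Variables (X : choiceType) (tw : V -> V -> word X).

Fixpoint path_word a (s : seq V) : word X :=
  if s is b :: s' then tw a b ++ path_word b s' else [::].

Definition loop_word (s : seq V) : word X :=
  if s is a :: s' then path_word a s' else [::].

Definition subst_word (Y : Type) (f : Y -> word X) (w : word Y) : word X :=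
  flatten [seq (if l.2 then f l.1 else winv (f l.1)) | l <- w].

Lemma weval_path_word (G : groupType) (f : X -> G) a s :
  weval f (path_word a s) = path_prod (fun i j => weval f (tw i j)) a s.
Proof.
by elim: s a => [|b s IHs] a /=; rewrite ?weval_nil // weval_cat IHs.
Qed.

Lemma weval_loop_word (G : groupType) (f : X -> G) s :
  weval f (loop_word s) = loop_prod (fun i j => weval f (tw i j)) s.
Proof. by case: s => [|a s] /=; rewrite ?weval_nil // weval_path_word. Qed.

Lemma weval_subst (Y : choiceType) (G : groupType) (f : X -> G) (g : Y -> word X) w :
  weval f (subst_word g w) = weval (fun y => weval f (g y)) w.
Proof.
elim: w => [|[y b] w IHw]; first by rewrite !weval_nil.
rewrite weval_cons -IHw /subst_word /= weval_cat; congr (_ * _).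
by case: b; rewrite //= weval_winv.
Qed.
End Words.
End PathProduct.

(** * The edge graph of a full subcomplex and its components *)

Section EdgeGraph.
Variables (m : nat) (K : {set {set 'I_m}}).
Implicit Type J : {set 'I_m}.

Definition edge J : rel 'I_m := fun i j => [&& i \in J, j \in J & [set i; j]%SET \in K].

Lemma edge_sym J : symmetric (edge J).
Proof. by move=> i j; rewrite /edge finset.setUC andbCA. Qed.

Lemma edge_connect_sym J : connect_sym (edge J).
Proof. by apply/sym_connect_sym/edge_sym. Qed.

Definition closed_path J (s : seq 'I_m) :=
  if s is a :: s' then path (edge J) a s' && (last a s' == a) else true.

(** A functor from the edge-path groupoid of [K_J] to G, or a flat local system. Degenerate faces
    are included: [{i}] gives [t i i = 1], and [{i,j}] then makes [t j i] the inverse of [t i j]. *)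
Definition functorial (G : groupType) J (t : 'I_m -> 'I_m -> G) :=
  forall i j k, [set i; j; k]%SET \in full_subcomplex K J -> (t i j * t j k)%g = t i k.

(** Marks the component whose arrow goes into the spanning tree; the value is [None] only for empty
    J. *)
Definition main_root J : option 'I_m :=
  omap (fingraph.root (edge J)) [pick i in J].

(** Representatives of the remaining components; [b0E] shows that their number is the reduced Betti
    number of [K_J]. *)
Definition other_root J (i : 'I_m) : bool :=
  [&& i \in J, fingraph.root (edge J) i == i & main_root J != Some i].

Lemma root_in J i : i \in J -> fingraph.root (edge J) i \in J.
Proof.
move=> iJ; case/connectP: (connect_root (edge J) i) => s.
elim/last_ind: s => [|s j _] /= => [_ ->//|].
by rewrite last_rcons rcons_path => /andP[_ /and3P[_ jJ _]] ->.
Qed.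

Lemma exists_root_path J i : exists s, path (edge J) (fingraph.root (edge J) i) s &&
  (last (fingraph.root (edge J) i) s == i).
Proof.
have : connect (edge J) (fingraph.root (edge J) i) i.
  by rewrite edge_connect_sym connect_root.
by case/connectP => s ps /esym/eqP si; exists s; rewrite ps si.
Qed.

Definition root_path J i : seq 'I_m := xchoose (exists_root_path J i).

Lemma root_pathP J i : path (edge J) (fingraph.root (edge J) i) (root_path J i).
Proof. by have /andP[] := xchooseP (exists_root_path J i). Qed.

Lemma last_root_path J i : last (fingraph.root (edge J) i) (root_path J i) = i.
Proof. by have /andP[_ /eqP] := xchooseP (exists_root_path J i). Qed.

End EdgeGraph.

(** * The presentation of Cart *)

Section CartPresentation.
Variables (m : nat) (K : {set {set 'I_m}}) (K_complex : simplicial_complex K).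
Variables (G : 'I_m -> groupType).
Implicit Type J : {set 'I_m}.
Local Notation P := (direct_product G).
Local Open Scope group_scope.

Definition supp (p : P) : {set 'I_m} := [set i | p i != 1]%SET.

Definition erase (p : P) (i : 'I_m) : P := fun j => if j == i then 1 else p j.

Lemma erase_in p i : erase p i i = 1. Proof. by rewrite /erase eqxx. Qed.

Lemma erase_out p i j : j != i -> erase p i j = p j.
Proof. by rewrite /erase => /negbTE->. Qed.

Lemma erase_id p i : p i = 1 -> erase p i = p.
Proof.
move=> pi1; apply/functional_extensionality_dep => j; rewrite /erase.
by case: eqP => // ->.
Qed.

Lemma eraseC p i j : erase (erase p i) j = erase (erase p j) i.
Proof.
by apply/functional_extensionality_dep => k; rewrite /erase; do 2 case: eqP.
Qed.

Lemma supp_erase p i : supp (erase p i) = (supp p :\ i)%SET.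
Proof.
by apply/setP => j; rewrite !inE /erase; case: (j == i) => //; rewrite eqxx.
Qed.

Lemma card_supp_erase p i : i \in supp p -> #|supp p| = #|supp (erase p i)|.+1.
Proof. by move=> ip; rewrite supp_erase (cardsD1 i) ip. Qed.

(** To be instantiated by [below (b0 R K J)] and [below (rk R K J)]. The algebra works with any
    indexing of the non-main components and of words of loops that detect holonomy. *)
Variables (B L : {set 'I_m} -> choiceType).
Variable rt : forall J, B J -> 'I_m.
Hypothesis rt_inj : forall J, injective (@rt J).
Hypothesis rtP : forall J i, other_root K J i <-> exists k, @rt J k = i.

Variable loops : forall J, L J -> word (seq 'I_m).
Hypothesis loops_closed :
  forall J k s b, (s, b) \in @loops J k -> closed_path K J s.
(** The form in which generation of [Pi_1(K_J)] enters: a functor that is trivial on the given words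
    of loops has path-independent transport. *)
Hypothesis loops_gen : forall J (H : groupType) (t : 'I_m -> 'I_m -> H),
  functorial K J t -> (forall k, weval (loop_prod t) (@loops J k) = 1) ->
  forall a s s', path (edge K J) a s -> path (edge K J) a s' -> last a s = last a s' ->
  path_prod t a s = path_prod t a s'.

Let Gen : choiceType := {J : {set 'I_m} & (n_type G J * B J)%type}.
Let Rel : choiceType := {J : {set 'I_m} & (n_type G J * L J)%type}.

Lemma suppP p (j : {j | j \in supp p}) : p (\val j) != 1.
Proof. by case: j => j /=; rewrite inE. Qed.

Definition restrict (p : P) : n_type G (supp p) :=
  fun j => exist (fun g => g != 1) (p (\val j)) (suppP j).
Arguments restrict : clear implicits.

Definition extend J (tau : n_type G J) : P := fun i =>
  if pselect (i \in J) is left iJ then \val (tau (exist _ i iJ)) else 1.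

Lemma extendE J (tau : n_type G J) i (iJ : i \in J) :
  extend tau i = \val (tau (exist _ i iJ)).
Proof.
by rewrite /extend; case: pselect => // iJ'; rewrite (bool_irrelevance iJ' iJ).
Qed.

Lemma extend_out J (tau : n_type G J) i : i \notin J -> extend tau i = 1.
Proof. by rewrite /extend; case: pselect => // iJ /negP. Qed.

Lemma supp_extend J (tau : n_type G J) : supp (extend tau) = J.
Proof.
apply/setP => i; rewrite inE; have [iJ|iJ] := boolP (i \in J).
  by rewrite extendE; exact: (valP (tau _)).
by rewrite extend_out// eqxx.
Qed.

Lemma restrictK p : extend (restrict p) = p.
Proof.
apply/functional_extensionality_dep => i.
have [ip|ip] := boolP (i \in supp p); first by rewrite extendE.
by rewrite extend_out//; move: ip; rewrite inE negbK => /eqP.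
Qed.

Definition gen_at p (k : B (supp p)) : Gen := existT _ (supp p) (restrict p, k).

(** Replacing J by [supp p] with p = [extend tau] avoids transport along equalities between
    supports. *)
Lemma genP (x : Gen) : exists p k, x = @gen_at p k.
Proof.
case: x => J [tau k]; move: (restrictK (extend tau)).
have [p pE] : exists p, p = extend tau by exists (extend tau).
have pJ : supp p = J by rewrite pE supp_extend.
move=> _; subst J; exists p, k; congr existT; congr pair.
apply/functional_extensionality_dep => -[j jp]; apply/val_inj => /=.
by rewrite -extendE -pE.
Qed.

(** Meant for a root i; the empty word at the main root encodes that tree arrows are 1. *)
Definition gen_word p i : word Gen :=
  if pselect (exists k, @rt (supp p) k = i) is left e
  then [:: (gen_at (sval (cid e)), true)] else [::].

Lemma gen_word_rt p k : gen_word p (rt k) = [:: (@gen_at p k, true)].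
Proof.
rewrite /gen_word; case: pselect => [e|[]]; last by exists k.
by rewrite (rt_inj (svalP (cid e))).
Qed.

Lemma gen_word_nil p i : ~~ other_root K (supp p) i -> gen_word p i = [::].
Proof. by rewrite /gen_word; case: pselect => // e /negP[]; exact/rtP. Qed.

(** The number n is fuel, to be started at the size of [supp p]. The arrow at i is the arrow at the
    root of its component, followed by the links along the chosen path from that root to i. *)
Fixpoint down_rec n (p : P) (i : 'I_m) : word Gen :=
  if n isn't n'.+1 then [::] else if p i == 1 then [::] else
  let r := fingraph.root (edge K (supp p)) i in
  gen_word p r ++ path_word (fun a b => down_rec n' (erase p a) b ++
     winv (down_rec n' (erase p b) a)) r (root_path K (supp p) i).

(* Represents the arrow from p to erase p i, every arrow of the tree being
   identified with 1. *)
Definition down p i := down_rec #|supp p| p i.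

(* The path from erase p a down to erase (erase p a) b and up to erase p b. *)
Definition link_word p a b := down (erase p a) b ++ winv (down (erase p b) a).

Lemma down1 p i : p i = 1 -> down p i = [::].
Proof.
by rewrite /down; case: #|supp p| => //= n ->; rewrite eqxx.
Qed.

Lemma eq_path_word (X : choiceType) (t t' : 'I_m -> 'I_m -> word X) (A : {set 'I_m}) a s :
  {in A &, t =2 t'} -> a \in A -> path (edge K A) a s ->
  path_word t a s = path_word t' a s.
Proof.
move=> tt'; elim: s a => //= b s IHs a aA /andP[/and3P[_ bA _] ps].
by rewrite tt'// IHs.
Qed.

Lemma downE p i : i \in supp p ->
  let r := fingraph.root (edge K (supp p)) i in
  down p i = gen_word p r ++ path_word (link_word p) r (root_path K (supp p) i).
Proof.
move=> ip r; rewrite /down (card_supp_erase ip) /=.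
have /negbTE -> : p i != 1 by move: ip; rewrite inE.
congr (_ ++ _); apply: (@eq_path_word _ _ _ (supp p)).
- move=> a b ap bp; rewrite /link_word /down.
  (* Every vertex of the root path lies in [supp p], so erasing any of them uses up the same one
     unit of fuel. *)
  have cd c : c \in supp p -> #|supp (erase p i)| = #|supp (erase p c)|.
    by move=> /card_supp_erase; rewrite (card_supp_erase ip) => -[].
  by rewrite -!cd.
- exact: root_in.
- exact: root_pathP.
Qed.

(** The induced homomorphism at the point p = [extend tau], evaluated on the word of loops that the
    index selects. *)
Definition relator (y : Rel) : word Gen :=
  subst_word (loop_word (link_word (extend (tagged y).1))) (loops (tagged y).2).

(** * The arrows realized in the graph product *)

Local Notation GK := (graph_product K G).
Local Notation proj := (graph_product_proj K G).

Definition syllable i (g : G i) : GK := wclass _ [:: letter g true].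

Lemma syllableM i (g h : G i) : syllable (g * h) = syllable g * syllable h.
Proof.
have := @wclass_rel _ (free_product_rel G `|` commutation_rel K (G:=G))
  [:: letter g true; letter h true; letter (g * h) false].
rewrite wclass_weval !weval_cons weval_nil /= mulg1 mulgA => /(_ _)/divg1_eq -> //.
by left; exists i, g, h.
Qed.

Lemma syllable1 i : syllable (1 : G i) = 1.
Proof. by apply: (mulgI (syllable (1 : G i))); rewrite -syllableM !mulg1. Qed.

Lemma syllableC i j (g : G i) (h : G j) : i != j -> [set i; j]%SET \in K ->
  syllable g * syllable h = syllable h * syllable g.
Proof.
move=> ij ijK; have := @wclass_rel _ (free_product_rel G `|` commutation_rel K (G:=G))
  [:: letter g true; letter h true; letter g false; letter h false].
rewrite wclass_weval !weval_cons weval_nil /= mulg1 mulgA -invgM => /(_ _)/divg1_eq -> //.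
by right; exists i, j, g, h.
Qed.

Lemma proj_syllable i (g : G i) k :
  proj (syllable g) k = dp_inj (Tagged (fun i => G i : Type) g) k.
Proof.
rewrite [proj _](wclass_lift (@dp_inj_rel m K G)).
by rewrite weval_cons weval_nil mulg1.
Qed.

Lemma proj_syllable_in i (g : G i) : proj (syllable g) i = g.
Proof. by rewrite proj_syllable /dp_inj /= dfwith_in. Qed.

Lemma proj_syllable_out i (g : G i) k : i != k -> proj (syllable g) k = 1.
Proof. by move=> ik; rewrite proj_syllable /dp_inj /= dfwith_out. Qed.

Fixpoint section_rec n (p : P) : GK :=
  if n isn't n'.+1 then 1 else
  if main_root K (supp p) is Some i then section_rec n' (erase p i) * syllable (p i)
  else 1.

(* The lift of p to the graph product along the spanning tree. *)
Definition tree_section p := section_rec #|supp p| p.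

Lemma main_root_in J i : main_root K J = Some i -> i \in J.
Proof.
by rewrite /main_root; case: pickP => //= j jJ [<-]; exact: root_in.
Qed.

Lemma main_root_root J i : main_root K J = Some i -> fingraph.root (edge K J) i = i.
Proof.
rewrite /main_root; case: pickP => //= j jJ [<-].
by rewrite root_root//; exact: edge_connect_sym.
Qed.

Lemma tree_sectionE p i : main_root K (supp p) = Some i ->
  tree_section p = tree_section (erase p i) * syllable (p i).
Proof.
by move=> pi; rewrite /tree_section (card_supp_erase (main_root_in pi)) /= pi.
Qed.

Lemma main_root_none p : main_root K (supp p) = None -> p = 1.
Proof.
rewrite /main_root; case: pickP => //= p0 _.
apply/functional_extensionality_dep => i; have := p0 i.
by rewrite inE => /negbT; rewrite negbK => /eqP.
Qed.

Lemma supp1 : supp 1 = finset.set0.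
Proof. by apply/setP => i; rewrite !inE eqxx. Qed.

Lemma tree_section1 : tree_section 1 = 1.
Proof. by rewrite /tree_section supp1 cards0. Qed.

Lemma supp_ind (Q : P -> Prop) :
  (forall p, (forall i, i \in supp p -> Q (erase p i)) -> Q p) -> forall p, Q p.
Proof.
move=> IH p; have [n] := ubnP #|supp p|; elim: n p => // n IHn p pn.
by apply: IH => i ip; apply: IHn; rewrite -ltnS -card_supp_erase.
Qed.

Lemma proj_section p : proj (tree_section p) = p.
Proof.
elim/supp_ind: p => p IH; case pi: (main_root K (supp p)) => [i|]; last first.
  by rewrite (main_root_none pi) tree_section1 morph1.
rewrite (tree_sectionE pi) gmulfM IH ?(main_root_in pi)//.
apply/functional_extensionality_dep => k; rewrite dp_mulE.
have [<-|ik] := eqVneq i k; first by rewrite erase_in mul1g proj_syllable_in.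
by rewrite proj_syllable_out// mulg1 erase_out// eq_sym.
Qed.

(** The loop at 1 that climbs the tree to p, crosses to [erase p i] and returns along the tree. *)
Definition arrow p i : GK :=
  tree_section p * (syllable (p i))^-1 * (tree_section (erase p i))^-1.

Lemma proj_arrow p i : proj (arrow p i) = 1.
Proof.
rewrite /arrow !gmulfM !morphV !proj_section.
apply/functional_extensionality_dep => k; rewrite !dp_mulE !dp_invE dp_oneE.
have [<-|ik] := eqVneq i k; first by rewrite proj_syllable_in erase_in mulgV mul1g invg1.
by rewrite proj_syllable_out// invg1 mulg1 erase_out 1?eq_sym// mulgV.
Qed.

Lemma arrow_kernel p i : in_kernel proj (arrow p i).
Proof. by apply/eqP; exact: proj_arrow. Qed.

Definition cart_arrow p i : Cart K G := exist _ (arrow p i) (arrow_kernel p i).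

(** The inner tree sections cancel, which leaves the commutation of the syllables [p i] and
    [p j]. *)
Lemma cart_arrow_square p i j : [set i; j]%SET \in K ->
  cart_arrow p i * cart_arrow (erase p i) j = cart_arrow p j * cart_arrow (erase p j) i.
Proof.
move=> ijK; have [->//|ij] := eqVneq i j.
apply/val_inj; rewrite !valM /= /arrow -!mulgA !mulKg eraseC !erase_out//; last first.
  by rewrite eq_sym.
by congr (_ * _); rewrite !mulgA -!invgM (syllableC (p i) (p j) ij ijK).
Qed.

Lemma cart_arrow_trivial p i : p i = 1 -> cart_arrow p i = 1.
Proof.
by move=> pi; apply/val_inj; rewrite /= /arrow erase_id// pi syllable1 invg1 mulg1 mulgV.
Qed.

Lemma cart_arrow_main p i : main_root K (supp p) = Some i -> cart_arrow p i = 1.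
Proof.
by move=> pi; apply/val_inj; rewrite /= /arrow (tree_sectionE pi) mulgK mulgV.
Qed.

Definition gen_arrow (x : Gen) : Cart K G :=
  cart_arrow (extend (tagged x).1) (rt (tagged x).2).

Lemma gen_arrow_at p k : gen_arrow (@gen_at p k) = cart_arrow p (rt k).
Proof. by rewrite /gen_arrow /= restrictK. Qed.

Lemma weval_gen_word p i : i \in supp p -> fingraph.root (edge K (supp p)) i = i ->
  weval gen_arrow (gen_word p i) = cart_arrow p i.
Proof.
move=> ip ri; have [/rtP[k <-]|oi] := boolP (other_root K (supp p) i).
  by rewrite gen_word_rt weval_cons weval_nil mulg1 gen_arrow_at.
rewrite gen_word_nil// weval_nil cart_arrow_main//.
by move: oi; rewrite /other_root ip ri eqxx /= negbK => /eqP.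
Qed.

(** A coboundary telescopes along a path. *)
Lemma path_prod_potential (H : groupType) (t : 'I_m -> 'I_m -> H) (c : 'I_m -> H) J a s :
  (forall i j, edge K J i j -> t i j = (c i)^-1 * c j) -> path (edge K J) a s ->
  path_prod t a s = (c a)^-1 * c (last a s).
Proof.
move=> tc; elim: s a => /= [a _|b s IHs a /andP[ab ps]]; first by rewrite mulVg.
by rewrite tc// IHs// mulgA mulgK.
Qed.

Lemma weval_link_word p i j :
  (forall i j, i \in supp p -> weval gen_arrow (down (erase p i) j) =
    cart_arrow (erase p i) j) ->
  edge K (supp p) i j ->
  weval gen_arrow (link_word p i j) = (cart_arrow p i)^-1 * cart_arrow p j.
Proof.
move=> IH /and3P[ip jp ijK]; rewrite /link_word weval_cat weval_winv !IH//.
apply: (mulgI (cart_arrow p i)); rewrite mulVKg mulgA cart_arrow_square//.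
by rewrite mulgK.
Qed.

(** By induction on the support, links become differences of the potential [cart_arrow p]; the
    product along the root path then telescopes from the arrow at the root to the arrow at i. *)
Lemma weval_down p i : weval gen_arrow (down p i) = cart_arrow p i.
Proof.
elim/supp_ind: p i => p IH i; have [ip|] := boolP (i \in supp p); last first.
  rewrite inE negbK => /eqP pi.
  by rewrite down1// weval_nil cart_arrow_trivial.
have pp := root_pathP K (supp p) i.
rewrite downE// weval_cat weval_path_word weval_gen_word ?root_in//; last first.
  by rewrite root_root//; exact: edge_connect_sym.
rewrite (path_prod_potential (c := cart_arrow p) _ pp); last first.
  by move=> a b ab; apply: weval_link_word => // c d cp; exact: IH.
by rewrite mulVKg last_root_path.
Qed.

Lemma weval_eq1 (X : choiceType) (H : groupType) (f : X -> H) w :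
  (forall x b, (x, b) \in w -> f x = 1) -> weval f w = 1.
Proof.
move=> f1; rewrite (eq_weval (g := fun=> 1) f1).
by elim: w {f1} => [|[x b] w IHw]; rewrite ?weval_nil// weval_cons IHw mulg1 invg1 if_same.
Qed.

Lemma weval_relator y : weval gen_arrow (relator y) = 1.
Proof.
case: y => J [tau k]; rewrite /relator /= weval_subst.
(* Already each single loop of the word is sent to 1, since a coboundary telescopes to 1 on a closed
   path. *)
apply: weval_eq1 => s b /loops_closed; rewrite weval_loop_word.
case: s => //= a s /andP[ps /eqP sa].
rewrite (@path_prod_potential _ _ (cart_arrow (extend tau)) J)//; last first.
  rewrite -{1}(supp_extend tau) => i j; apply: weval_link_word => {}i {}j _.
  exact: weval_down.
by rewrite sa mulVg.
Qed.

(** * The presented group and its commuting squares *)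

Local Notation Gamma := (pgroup (range relator)).

Lemma gen_arrow_rel r : range relator r -> weval gen_arrow r = 1.
Proof. by case=> y _ <-; exact: weval_relator. Qed.

Definition to_cart : {multiplicative Gamma -> Cart K G} := pgroup_lift gen_arrow_rel.

Lemma to_cartE w : to_cart (wclass _ w) = weval gen_arrow w.
Proof. exact: (wclass_lift gen_arrow_rel). Qed.

Definition abstract_arrow p i : Gamma := wclass _ (down p i).
Local Notation d := abstract_arrow.

Lemma abstract_arrow1 p i : p i = 1 -> d p i = 1.
Proof. by move=> pi; rewrite /d down1. Qed.

Definition link p a b : Gamma := d (erase p a) b * (d (erase p b) a)^-1.

Lemma wclass_link_word p i j :
  weval (fun x => wclass _ [:: (x, true)] : Gamma) (link_word p i j) = link p i j.
Proof. by rewrite -wclass_weval wclass_cat wclass_winv. Qed.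

Lemma wclass_path_link p a s :
  wclass _ (path_word (link_word p) a s) = path_prod (link p) a s.
Proof.
rewrite wclass_weval weval_path_word; congr path_prod.
by apply/funext => i; apply/funext => j; exact: wclass_link_word.
Qed.

Lemma link_relations p k : weval (loop_prod (link p)) (@loops (supp p) k) = 1.
Proof.
transitivity (wclass (range relator) (relator (existT _ (supp p) (restrict p, k)))).
  rewrite wclass_weval /relator /= weval_subst restrictK; congr weval.
  apply/funext => s; rewrite weval_loop_word; congr loop_prod.
  by apply/funext => i; apply/funext => j; rewrite wclass_link_word.
by apply: wclass_rel; eexists.
Qed.

(* For a face {a,b,c}, only the three squares of the 3-cube below p that avoid p
   are used. *)
Lemma link_functorial p :
  (forall a, a \in supp p -> forall i j, [set i; j]%SET \in K ->
    d (erase p a) i * d (erase (erase p a) i) j =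
    d (erase p a) j * d (erase (erase p a) j) i) ->
  functorial K (supp p) (link p).
Proof.
move=> IH a b c; rewrite inE => /andP[abcK abcp].
have [_ _ Kdown] := K_complex.
have abK : [set a; b]%SET \in K by apply: Kdown abcK _; exact: finset.subsetUl.
have bcK : [set b; c]%SET \in K.
  by apply: Kdown abcK _; apply/fintype.subsetP => x; rewrite !inE => /orP[]->; rewrite ?orbT.
have acK : [set a; c]%SET \in K.
  by apply: Kdown abcK _; apply/fintype.subsetP => x; rewrite !inE => /orP[]->; rewrite ?orbT.
have [ap bp cp] : [/\ a \in supp p, b \in supp p & c \in supp p].
  by split; apply: (fintype.subsetP abcp); rewrite !inE eqxx ?orbT.
have := IH b bp a c acK; have := IH a ap b c bcK; have := IH c cp a b abK.
rewrite /link (eraseC p b a) (eraseC p c a) (eraseC p c b).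
move: (d (erase p a) b) (d (erase p b) a) (d (erase p b) c) (d (erase p c) b)
  (d (erase p a) c) (d (erase p c) a) (d (erase (erase p a) b) c)
  (d (erase (erase p a) c) b) (d (erase (erase p b) c) a).
move=> ab ba bc cb ac ca u w v e1 e2 e3.
have -> : ab = ac * w * u^-1 by rewrite -e2 mulgK.
have -> : ba = bc * v * u^-1 by rewrite -e3 mulgK.
have -> : ca = cb * v * w^-1 by rewrite -e1 mulgK.
by rewrite !invgM !invgK !mulgA !mulgVK.
Qed.

(** By induction on the support the links at p are functorial, and the relators at p make their
    transport path-independent. As i and j share a root, the arrows at i and j then differ by
    [link p i j], which is the square. *)
Lemma abstract_square p i j : [set i; j]%SET \in K ->
  d p i * d (erase p i) j = d p j * d (erase p j) i.
Proof.
elim/supp_ind: p i j => p IH i j ijK.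
have [->//|ij] := eqVneq i j.
have [ip|] := boolP (i \in supp p); last first.
  rewrite inE negbK => /eqP pi.
  (* Erasing a trivial coordinate is an identity arrow, so the square degenerates. *)
  rewrite (abstract_arrow1 pi) (erase_id pi) mul1g.
  by rewrite [d (erase _ _) _]abstract_arrow1 ?mulg1// erase_out.
have [jp|] := boolP (j \in supp p); last first.
  rewrite inE negbK => /eqP pj.
  rewrite (abstract_arrow1 pj) (erase_id pj) mul1g.
  rewrite [d (erase _ _) _]abstract_arrow1 ?mulg1// erase_out//.
  by rewrite eq_sym.
have F := link_functorial IH.
have U := loops_gen F (@link_relations p).
have dE a : a \in supp p -> d p a =
    wclass _ (gen_word p (fingraph.root (edge K (supp p)) a)) *
    path_prod (link p) (fingraph.root (edge K (supp p)) a) (root_path K (supp p) a).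
  by move=> ap; rewrite /d downE// wclass_cat wclass_path_link.
have eij : edge K (supp p) i j by rewrite /edge ip jp.
have rij : fingraph.root (edge K (supp p)) i = fingraph.root (edge K (supp p)) j.
  by apply/eqP; rewrite root_connect ?connect1//; exact: edge_connect_sym.
suff -> : d p j = d p i * link p i j by rewrite /link -!mulgA mulVg mulg1.
rewrite !dE// rij -mulgA; congr (_ * _).
(* The root path of i prolonged by the edge to j and the root path of j have the same ends. *)
rewrite -(@U _ (rcons (root_path K (supp p) i) j)).
- by rewrite -rij -cats1 path_prod_cat last_root_path /= mulg1.
- by rewrite -rij rcons_path root_pathP last_root_path.
- exact: root_pathP.
- by rewrite last_rcons last_root_path.
Qed.

(** The chosen path from a root to itself may be nonempty, but it is closed, so its transport agrees
    with that of the empty path. *)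
Lemma abstract_arrow_root p i : i \in supp p ->
  fingraph.root (edge K (supp p)) i = i -> d p i = wclass _ (gen_word p i).
Proof.
move=> ip ri; rewrite /d downE// ri wclass_cat wclass_path_link.
have F : functorial K (supp p) (link p).
  by apply: link_functorial => a _ j k jkK; exact: abstract_square.
rewrite (loops_gen F (@link_relations p) (s' := [::])) ?mulg1//.
  by have := root_pathP K (supp p) i; rewrite ri.
by have := last_root_path K (supp p) i; rewrite ri.
Qed.

(** * The inverse map, as a cocycle on words *)

Local Notation inj := (@dp_inj m G).
Local Notation tag_of := (Tagged (fun i => G i : Type)).

(* Right multiplication by x, as an arrow p -> p x, factors through the erasure
   of the coordinate of x. *)
Definition letter_cocycle p (x : {i : 'I_m & G i}) : Gamma :=
  d p (tag x) * (d (p * inj x) (tag x))^-1.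

(** Reads w as a path of the groupoid starting at p. A letter marked [false] runs backwards along
    the arrow that starts at p times the inverse of x. *)
Fixpoint cocycle p (w : word {i : 'I_m & G i}) : Gamma :=
  if w isn't (x, b) :: w' then 1 else
  if b then letter_cocycle p x * cocycle (p * inj x) w'
  else (letter_cocycle (p * (inj x)^-1) x)^-1 * cocycle (p * (inj x)^-1) w'.

Lemma cocycle_cat p u v :
  cocycle p (u ++ v) = cocycle p u * cocycle (p * weval inj u) v.
Proof.
elim: u p => [|[x b] u IHu] p /=; first by rewrite weval_nil mul1g mulg1.
by rewrite weval_cons; case: b => /=; rewrite IHu !mulgA.
Qed.

Lemma inj_in i (g : G i) : inj (tag_of g) i = g.
Proof. exact: dfwith_in. Qed.

Lemma inj_out i (g : G i) j : j != i -> inj (tag_of g) j = 1.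
Proof. by move=> ji; apply: dfwith_out; rewrite eq_sym. Qed.

Lemma injM i (g h : G i) : inj (tag_of (g * h)) = inj (tag_of g) * inj (tag_of h).
Proof.
apply/functional_extensionality_dep => k; rewrite dp_mulE.
have [->|ki] := eqVneq k i; first by rewrite !inj_in.
by rewrite !inj_out// mulg1.
Qed.

Lemma injC i j (g : G i) (h : G j) : i != j ->
  inj (tag_of g) * inj (tag_of h) = inj (tag_of h) * inj (tag_of g).
Proof.
move=> ij; apply/functional_extensionality_dep => k; rewrite !dp_mulE.
have [->|ki] := eqVneq k i; first by rewrite (inj_out h)// mulg1 mul1g.
by rewrite (inj_out g)// mulg1 mul1g.
Qed.

Lemma erase_inj p i (g : G i) : erase (p * inj (tag_of g)) i = erase p i.
Proof.
apply/functional_extensionality_dep => k; rewrite /erase; case: eqVneq => [//|ki].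
by rewrite dp_mulE inj_out// mulg1.
Qed.

(** All three arrows factor through the same [erase p i], so the middle terms cancel. *)
Lemma letter_cocycleM p i (g h : G i) :
  letter_cocycle p (tag_of (g * h)) =
  letter_cocycle p (tag_of g) * letter_cocycle (p * inj (tag_of g)) (tag_of h).
Proof. by rewrite /letter_cocycle /= injM !mulgA mulgVK. Qed.

Lemma letter_cocycleC p i j (g : G i) (h : G j) : i != j -> [set i; j]%SET \in K ->
  letter_cocycle p (tag_of g) * letter_cocycle (p * inj (tag_of g)) (tag_of h) =
  letter_cocycle p (tag_of h) * letter_cocycle (p * inj (tag_of h)) (tag_of g).
Proof.
move=> ij ijK; rewrite /letter_cocycle /=.
set a := inj (tag_of g); set b := inj (tag_of h).
(* The rectangle with corners p, pa, pb, pab is cut into the four squares at its corners; all four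
   share the point with coordinates i and j erased. *)
have := abstract_square p ijK; have := abstract_square (p * a) ijK.
have := abstract_square (p * b) ijK; have := abstract_square (p * a * b) ijK.
have ji : j != i by rewrite eq_sym.
have -> : erase (p * a * b) i = erase (p * b) i by rewrite -mulgA injC// mulgA erase_inj.
have pab : p * b * a = p * a * b by rewrite -!mulgA (injC g h ij).
rewrite pab !erase_inj.
move: (d (erase p i) j) (d (erase p j) i) (d (erase (p * a) j) i) (d (erase (p * b) i) j).
move: (d p i) (d p j) (d (p * a) i) (d (p * a) j) (d (p * b) i) (d (p * b) j).
move: (d (p * a * b) i) (d (p * a * b) j) => qi qj pi pj ai aj bi bj x y u v eq eb ea ep.
have -> : aj = ai * x * u^-1 by rewrite ea mulgK.
have -> : bi = bj * y * v^-1 by rewrite -eb mulgK.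
rewrite !mulgA !mulgVK ep -(mulgA _ u^-1) -(mulgA _ v^-1) -!invgM.
by rewrite eq.
Qed.

Lemma cocycle_rel p r : (free_product_rel G `|` commutation_rel K (G:=G))%classic r ->
  cocycle p r = 1.
Proof.
case=> [[i [g [h ->]]]|[i [j [g [h [ij ijK ->]]]]]] /=; rewrite mulg1.
  have -> : p * inj (tag_of g) * inj (tag_of h) * (inj (tag_of (g * h)))^-1 = p.
    by rewrite injM -(mulgA p) mulgK.
  by rewrite letter_cocycleM mulgA mulgV.
have -> : p * inj (tag_of g) * inj (tag_of h) * (inj (tag_of g))^-1 = p * inj (tag_of h).
  by rewrite -(mulgA p) injC// mulgA mulgK.
by rewrite mulgK mulgA letter_cocycleC// -invgM mulgV.
Qed.

Lemma cocycle_pres_eq u v :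
  pres_eq (free_product_rel G `|` commutation_rel K (G:=G)) u v ->
  forall p, cocycle p u = cocycle p v.
Proof.
elim=> {u v} // [u v t _ uv _ vt p|u v x b p|u v r rr p].
- by rewrite uv vt.
- rewrite !cocycle_cat; congr (_ * _).
  rewrite !weval_cons weval_nil /=; set q := p * _.
  by case: b => /=; rewrite !mulg1 ?(mulgK, mulgVK) ?(mulVg, mulgV) ?mulg1 mul1g.
- rewrite !cocycle_cat (cocycle_rel _ rr) mul1g; congr (_ * cocycle _ _).
  by rewrite (dp_inj_rel rr) mulg1.
Qed.

Definition cart_cocycle p (x : GK) : Gamma := cocycle p (repr x).

Lemma cart_cocycleE p w : cart_cocycle p (wclass _ w) = cocycle p w.
Proof.
apply: cocycle_pres_eq; apply/wclass_eq; exact: reprK.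
Qed.

Lemma cart_cocycleM p x y :
  cart_cocycle p (x * y) = cart_cocycle p x * cart_cocycle (p * proj x) y.
Proof.
have [u ->] := wclassP x; have [v ->] := wclassP y.
rewrite -wclass_cat !cart_cocycleE cocycle_cat; congr (_ * cocycle (p * _) _).
by rewrite [RHS](wclass_lift (@dp_inj_rel m K G)).
Qed.

Lemma cart_cocycle1 p : cart_cocycle p 1 = 1.
Proof. exact: (cart_cocycleE p [::]). Qed.

Lemma cart_cocycleV p x :
  cart_cocycle p x^-1 = (cart_cocycle (p * (proj x)^-1) x)^-1.
Proof.
apply/esym/mulg1_eq; have := cart_cocycleM (p * (proj x)^-1) x x^-1.
by rewrite mulgV cart_cocycle1 mulgVK.
Qed.

Lemma proj_syllableE i (g : G i) : proj (syllable g) = inj (tag_of g).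
Proof. by apply/functional_extensionality_dep => k; rewrite proj_syllable. Qed.

Lemma cart_cocycle_syllable p i (g : G i) :
  cart_cocycle p (syllable g) = d p i * (d (p * inj (tag_of g)) i)^-1.
Proof. by rewrite cart_cocycleE /= mulg1. Qed.

Lemma erase_mul p i : erase p i * inj (tag_of (p i)) = p.
Proof.
apply/functional_extensionality_dep => k; rewrite dp_mulE.
have [->|ki] := eqVneq k i; first by rewrite inj_in erase_in mul1g.
by rewrite inj_out// erase_out// mulg1.
Qed.

Lemma abstract_arrow_main p i : main_root K (supp p) = Some i -> d p i = 1.
Proof.
move=> pi; have ip := main_root_in pi; have ri := main_root_root pi.
rewrite abstract_arrow_root// gen_word_nil//.
by rewrite /other_root pi eqxx !andbF.
Qed.

(** The section climbs along tree arrows only, and these are 1 in [Gamma]. *)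
Lemma cart_cocycle_section p : cart_cocycle 1 (tree_section p) = 1.
Proof.
elim/supp_ind: p => p IH; case pi: (main_root K (supp p)) => [i|]; last first.
  by rewrite (main_root_none pi) tree_section1 cart_cocycle1.
rewrite (tree_sectionE pi) cart_cocycleM IH ?(main_root_in pi)// mul1g mul1g.
rewrite proj_section cart_cocycle_syllable erase_mul (abstract_arrow_main pi).
by rewrite (abstract_arrow1 (erase_in p i)) mulgV.
Qed.

Lemma cart_cocycle_arrow p i : cart_cocycle 1 (arrow p i) = d p i.
Proof.
rewrite /arrow -mulgA cart_cocycleM cart_cocycle_section mul1g mul1g proj_section.
rewrite cart_cocycleM !cart_cocycleV morphV proj_syllableE proj_section.
have -> : p * (inj (tag_of (p i)))^-1 = erase p i.
  by rewrite -{1}(erase_mul p i) mulgK.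
rewrite mulgV cart_cocycle_section invg1 mulg1 cart_cocycle_syllable erase_mul.
by rewrite (abstract_arrow1 (erase_in p i)) mul1g invgK.
Qed.

Definition from_cart (x : Cart K G) : Gamma := cart_cocycle 1 (\val x).

(** An element of the kernel returns to the point 1, so the cocycle identity becomes
    multiplicativity. *)
Lemma from_cartM x y : from_cart (x * y) = from_cart x * from_cart y.
Proof.
rewrite /from_cart valM cart_cocycleM; congr (_ * cart_cocycle _ _).
by have /eqP -> := valP x; rewrite mulg1.
Qed.

HB.instance Definition _ := isMultiplicative.Build (Cart K G) Gamma from_cart from_cartM.

(** It suffices to treat generators: [gen_at p k] becomes the arrow at a non-main root, where [down]
    reduces in [Gamma] to that generator. *)
Lemma to_cartK : cancel to_cart from_cart.
Proof.
move=> a; have [w ->] := wclassP a; rewrite to_cartE [from_cart _]weval_morph.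
rewrite [RHS]wclass_weval; congr weval; apply/funext => x /=.
have [p [k ->]] := genP x.
rewrite gen_arrow_at /from_cart /= cart_cocycle_arrow.
have : other_root K (supp p) (rt k) by apply/rtP; exists k.
by case/and3P => ip /eqP ri _; rewrite abstract_arrow_root// gen_word_rt.
Qed.

(** Mapped to the graph product, the cocycle is w closed up by tree sections at both ends. The point
    p is arbitrary because the induction moves it; p = 1 gives the second inverse identity. *)
Lemma val_to_cart_cocycle p w :
  \val (to_cart (cocycle p w)) =
  tree_section p * wclass _ w * (tree_section (p * weval inj w))^-1.
Proof.
elim: w p => [|[x b] w IHw] p.
  by rewrite /= morph1 weval_nil wclass_nil !mulg1 mulgV.
have cx q : \val (to_cart (letter_cocycle q x)) =
    tree_section q * wclass _ [:: (x, true)] * (tree_section (q * inj x))^-1.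
  (* The arrow out of q contributes the inverse of [q i] and the reversed arrow contributes
     [q i * g]; together they give g. *)
  case: x => i g; rewrite /letter_cocycle gmulfM morphV !to_cartE !weval_down valM.
  rewrite morphV /= /arrow erase_inj dp_mulE inj_in syllableM !invgM !invgK !mulgA.
  by rewrite !mulgVK.
rewrite weval_cons -cat1s wclass_cat !mulgA; case: b.
  have -> : cocycle p ([:: (x, true)] ++ w) =
    letter_cocycle p x * cocycle (p * inj x) w by [].
  by rewrite gmulfM valM IHw cx !mulgA mulgVK.
have vV (z : Cart K G) : \val (z^-1) = (\val z)^-1 by exact: morphV.
have -> : cocycle p ([:: (x, false)] ++ w) =
  (letter_cocycle (p * (inj x)^-1) x)^-1 * cocycle (p * (inj x)^-1) w by [].
have -> : wclass (free_product_rel G `|` commutation_rel K (G:=G)) [:: (x, false)] =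
  (wclass _ [:: (x, true)])^-1 by rewrite -wclass_winv.
by rewrite gmulfM valM IHw morphV vV cx !invgM !invgK !mulgVK !mulgA mulgVK.
Qed.

Lemma from_cartK : cancel from_cart to_cart.
Proof.
move=> x; apply/val_inj; rewrite /from_cart; have [w xw] := wclassP (\val x).
rewrite xw cart_cocycleE val_to_cart_cocycle tree_section1 mul1g mul1g.
have -> : weval inj w = 1.
  by rewrite -(wclass_lift (@dp_inj_rel m K G)) -xw; exact/eqP/(valP x).
by rewrite tree_section1 invg1 mulg1.
Qed.

Lemma Cart_presented : presents relator (Cart K G).
Proof. by exists to_cart; exists from_cart; [exact: to_cartK|exact: from_cartK]. Qed.

End CartPresentation.

(** * Holonomy along paths in the realization *)

Section Subdivision.
Variables (R : realType) (m : nat).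
Local Open Scope classical_set_scope.
Local Open Scope ring_scope.

(* A Lebesgue number for the cover of the realization by open vertex stars. *)
Lemma grid_cover (F : R -> R -> 'rV[R]_m) :
  (forall i, continuous (fun su : R * R => F su.1 su.2 ord0 i)) ->
  (forall s u, exists i, F s u ord0 i != 0) ->
  exists n (w : nat -> nat -> 'I_m), (0 < n)%N /\ forall k l, (k < n)%N -> (l < n)%N ->
    forall s u, k%:R / n%:R <= s <= k.+1%:R / n%:R ->
      l%:R / n%:R <= u <= l.+1%:R / n%:R -> F s u ord0 (w k l) != 0.
Proof.
move=> cF nzF.
(* [P n x] says that the closed square of radius 1/(n+1) around x is mapped into one open star;
   compactness makes n uniform. *)
pose P (n : nat) (x : R * R) := exists i, forall y : R * R,
  `|y.1 - x.1| <= n.+1%:R^-1 -> `|y.2 - x.2| <= n.+1%:R^-1 -> F y.1 y.2 ord0 i != 0.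
have cI : compact (`[0, 1] `*` `[0, 1] : set (R * R)).
  by apply: compact_setX; exact: segment_compact.
have : \forall n \near \oo, (`[0, 1] `*` `[0, 1] : set (R * R)) `<=` P n.
  move/compact_near_coveringP : cI; apply => x _.
  have [i xi] := nzF x.1 x.2.
  have : nbhs x [set y | F y.1 y.2 ord0 i != 0].
    apply: (cF i x [set z | z != 0]); apply: open_nbhs_nbhs; split => //.
  case/nbhs_ballP => e /= e0 xe; have e20 : 0 < e / 2 by rewrite divr_gt0.
  (* Half of e goes to moving the centre from x to x', half to the radius around x'. *)
  exists (ball x (e / 2), [set n | n.+1%:R^-1 < e / 2]).
    split; first exact: nbhsx_ballx.
    exact: (near_infty_natSinv_lt (PosNum e20)).
  move=> [x' n] /= [[x1 x2] ne].
  have ball_add (a b c : R) : ball a (e / 2) b -> `|c - b| <= n.+1%:R^-1 -> ball a e c.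
    rewrite -!ball_normE /= => ab bc; apply: le_lt_trans (ler_distD b _ _) _.
    by rewrite (distrC b); have := le_lt_trans bc ne; lra.
  by exists i => y y1 y2; apply: xe; split; [exact: ball_add x1 y1|exact: ball_add x2 y2].
case=> N _ /(_ N (leqnn N)) NP.
have cell k : (k < N.+1)%N -> (k%:R / N.+1%:R : R) \in `[0, 1].
  move=> kN; rewrite in_itv /= divr_ge0//= ler_pdivrMr// mul1r ler_nat.
  exact: ltnW.
have pw k l : exists i, (k < N.+1)%N -> (l < N.+1)%N -> forall s u,
    k%:R / N.+1%:R <= s <= k.+1%:R / N.+1%:R ->
    l%:R / N.+1%:R <= u <= l.+1%:R / N.+1%:R -> F s u ord0 i != 0.
  have [kN|kN] := ltnP k N.+1; last by have [i _] := nzF 0 0; exists i.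
  have [lN|lN] := ltnP l N.+1; last by have [i _] := nzF 0 0; exists i.
  have [|i iP] := NP (k%:R / N.+1%:R, l%:R / N.+1%:R); first by split; exact: cell.
  have near_cell j r : j%:R / N.+1%:R <= r <= j.+1%:R / N.+1%:R ->
      `|r - j%:R / N.+1%:R| <= (N.+1%:R : R)^-1.
    rewrite -[j.+1]addn1 natrD mulrDl mul1r; move: (j%:R / _) => a; move: (_^-1) => b.
    by move=> /andP[r1 r2]; rewrite ger0_norm; lra.
  by exists i => _ _ s u sk ul; apply: (iP (s, u)); exact: near_cell.
exists N.+1, (fun k l => sval (cid (pw k l))); split=> // k l kN lN s u.
by move: (svalP (cid (pw k l))) => /(_ kN lN s u).
Qed.

(** As in simplicial approximation: the k-th of n equal cells of [0,1] is mapped into the open star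
    of [v k]. *)
Definition star_approx (g : R -> 'rV[R]_m) n (v : nat -> 'I_m) :=
  (0 < n)%N /\ forall k, (k < n)%N -> forall u, k%:R / n%:R <= u <= k.+1%:R / n%:R ->
    g u ord0 (v k) != 0.

(** A path is a homotopy constant in its first variable; the first row of the grid gives the
    approximation. *)
Lemma path_approx (g : R -> 'rV[R]_m) :
  (forall i, continuous (fun u => g u ord0 i)) ->
  (forall u, exists i, g u ord0 i != 0) -> exists n v, star_approx g n v.
Proof.
move=> cg nz; have [||n [w [n0 wn]]] := @grid_cover (fun _ u => g u).
- move=> i; apply: (@cts_comp _ _ _ snd (fun u => g u ord0 i)); last exact: cg.
  exact: snd_continuous.
- by move=> _; exact: nz.
exists n, (w 0%N); split=> // k kn u; apply: (wn _ _ n0 kn 0).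
by rewrite mul0r lexx divr_ge0.
Qed.

Lemma approx_refine g n v q : (0 < q)%N -> star_approx g n v ->
  star_approx g (n * q) (fun k => v (k %/ q)%N).
Proof.
move=> q0 [n0 gv]; split=> [|k kn u /andP[ku uk]]; first by rewrite muln_gt0 n0.
have nq0 : (0 : R) < (n * q)%:R by rewrite ltr0n muln_gt0 n0.
have n0R : (0 : R) < n%:R by rewrite ltr0n.
apply: gv; first by rewrite ltn_divLR.
rewrite ler_pdivrMr// ler_pdivlMr//.
move: ku uk; rewrite ler_pdivrMr// ler_pdivlMr// => ku uk.
have q0R : (0 : R) < q%:R by rewrite ltr0n.
rewrite -(ler_pM2r q0R) -[X in _ && X](ler_pM2r q0R) -!mulrA -!natrM.
apply/andP; split.
  by apply: le_trans ku; rewrite ler_nat leq_trunc_div.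
by apply: (le_trans uk); rewrite ler_nat -ltn_divLR ?leqnn// .
Qed.
End Subdivision.

(** * Transport along star approximations of curves *)

Section Holonomy.
Variables (R : realType) (m : nat) (K : {set {set 'I_m}}).
Hypothesis K_complex : simplicial_complex K.
Variable J : {set 'I_m}.
Local Open Scope classical_set_scope.
Local Open Scope ring_scope.
Local Notation X := (realization R (full_subcomplex K J)).

Lemma realization_face x a b c : X x -> x ord0 a != 0 -> x ord0 b != 0 -> x ord0 c != 0 ->
  [set a; b; c]%SET \in full_subcomplex K J.
Proof.
move=> [_ _]; rewrite !inE => /andP[xK xJ] a0 b0 c0; have [_ _ Kdown] := K_complex.
have abc : [set a; b; c]%SET \subset [set i | x ord0 i != 0]%SET.
  by apply/fintype.subsetP => i; rewrite !inE => /orP[/orP[]|] /eqP ->.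
by rewrite (Kdown _ _ xK abc) (fintype.subset_trans abc xJ).
Qed.

Lemma realization_edge x a b : X x -> x ord0 a != 0 -> x ord0 b != 0 -> edge K J a b.
Proof.
move=> Xx a0 b0; have := realization_face Xx a0 b0 b0.
rewrite inE -finset.setUA finset.setUid => /andP[abK abJ].
rewrite /edge abK andbT; apply/andP.
by split; apply: (fintype.subsetP abJ); rewrite !inE eqxx ?orbT.
Qed.

Lemma realization_nonzero x : X x -> exists i, x ord0 i != 0.
Proof.
move=> [_ x1 _]; apply/existsP; apply: contraPT x1 => /existsPn x0.
rewrite big1 => [|i _]; first by apply/eqP; rewrite eq_sym oner_eq0.
by apply/eqP; rewrite -[_ == _]negbK x0.
Qed.

Section Transport.
Variables (G : groupType) (t : 'I_m -> 'I_m -> G).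
Hypothesis tF : functorial K J t.
Local Notation "x *g y" := (x * y)%g (at level 40, left associativity).

Lemma transportM x a b c : X x -> x ord0 a != 0 -> x ord0 b != 0 -> x ord0 c != 0 ->
  t a b *g t b c = t a c.
Proof. by move=> Xx a0 b0 c0; apply/tF/(realization_face Xx). Qed.

Lemma transport1 x a : X x -> x ord0 a != 0 -> t a a = 1%g.
Proof. by move=> Xx a0; apply: (mulgI (t a a)); rewrite mulg1 (transportM Xx). Qed.

Definition walk a v k := path_prod t a (mkseq v k.+1).

Lemma walk0 a v : walk a v 0 = t a (v 0%N).
Proof. by rewrite /walk /= mulg1. Qed.

Lemma path_prod_rcons a s b : path_prod t a (rcons s b) = path_prod t a s *g t (last a s) b.
Proof. by rewrite -cats1 path_prod_cat /= mulg1. Qed.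

Lemma last_mkseq a (v : nat -> 'I_m) k : last a (mkseq v k.+1) = v k.
Proof. by rewrite mkseqS last_rcons. Qed.

Lemma walkS a v k : walk a v k.+1 = walk a v k *g t (v k) (v k.+1).
Proof. by rewrite /walk mkseqS path_prod_rcons last_mkseq. Qed.

Lemma walk_end a v k b : path_prod t a (rcons (mkseq v k.+1) b) = walk a v k *g t (v k) b.
Proof. by rewrite path_prod_rcons last_mkseq. Qed.

Implicit Type g : R -> 'rV[R]_m.

Lemma cell_left n k : k%:R / n%:R <= (k%:R / n%:R : R) <= k.+1%:R / n%:R.
Proof. by rewrite lexx ler_wpM2r ?invr_ge0// ler_nat. Qed.

Lemma cell_right n k : k%:R / n%:R <= (k.+1%:R / n%:R : R) <= k.+1%:R / n%:R.
Proof. by rewrite lexx ler_wpM2r ?invr_ge0// ler_nat. Qed.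

Lemma approx_left g n v k : star_approx g n v -> (k < n)%N -> g (k%:R / n%:R) ord0 (v k) != 0.
Proof. by move=> [_ gv] kn; apply: gv => //; exact: cell_left. Qed.

Lemma approx_right g n v k : star_approx g n v -> (k < n)%N ->
  g (k.+1%:R / n%:R) ord0 (v k) != 0.
Proof. by move=> [_ gv] kn; apply: gv => //; exact: cell_right. Qed.

(** The two sequences run side by side. The point between two consecutive cells lies in all four
    stars involved, so the rung from [v k] to [v' k] can be pushed to the next one. *)
Lemma walk_ladder g n v v' a k : (forall u, X (g u)) -> g 0 ord0 a != 0 ->
  star_approx g n v -> star_approx g n v' -> (k < n)%N ->
  walk a v k *g t (v k) (v' k) = walk a v' k.
Proof.
move=> Xg ga gv gv'; elim: k => [|k IHk] kn.
  rewrite !walk0 (@transportM (g 0))//.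
    by have := approx_left gv kn; rewrite mul0r.
  by have := approx_left gv' kn; rewrite mul0r.
have kn' : (k < n)%N by exact: ltnW.
have gk := approx_right gv kn'; have gk' := approx_right gv' kn'.
have gS := approx_left gv kn; have gS' := approx_left gv' kn.
rewrite !walkS -(IHk kn') -!mulgA; congr (_ *g _).
by rewrite !(@transportM (g (k.+1%:R / n%:R))).
Qed.

(** The refined sequence repeats each vertex q times, and repetitions contribute [t a a = 1]. *)
Lemma walk_refine g n v a q k : (forall u, X (g u)) -> star_approx g n v -> (0 < q)%N ->
  (k < n * q)%N -> walk a (fun k => v (k %/ q)%N) k = walk a v (k %/ q).
Proof.
move=> Xg gv q0; elim: k => [|k IHk] kn; first by rewrite div0n !walk0 div0n.
rewrite walkS IHk; last exact: ltnW.
have [|] := boolP (q %| k.+1)%N => qk.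
  have -> : (k.+1 %/ q = (k %/ q).+1)%N by rewrite divnS// qk.
  by rewrite walkS.
have -> : (k.+1 %/ q = k %/ q)%N by rewrite divnS// (negbTE qk).
have kq : (k %/ q < n)%N by rewrite ltn_divLR// ltnW.
by rewrite (transport1 (Xg _) (approx_left gv kq)) mulg1.
Qed.

Lemma approx_last g n v : star_approx g n.+1 v -> g 1 ord0 (v n) != 0.
Proof. by move=> gv; have := approx_right gv (ltnSn n); rewrite divff ?pnatr_eq0. Qed.

Lemma holonomy_same g n v v' a b : (forall u, X (g u)) ->
  g 0 ord0 a != 0 -> g 1 ord0 b != 0 -> star_approx g n v -> star_approx g n v' ->
  path_prod t a (rcons (mkseq v n) b) = path_prod t a (rcons (mkseq v' n) b).
Proof.
case: n => [|n]; first by move=> _ _ _ [].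
move=> Xg ga gb gv gv'; rewrite !walk_end -(walk_ladder Xg ga gv gv' (ltnSn n)) -[RHS]mulgA.
by rewrite (@transportM (g 1)) ?approx_last.
Qed.

Lemma holonomy_refine g n v a b q : (forall u, X (g u)) -> star_approx g n v -> (0 < q)%N ->
  path_prod t a (rcons (mkseq (fun k => v (k %/ q)%N) (n * q)) b) =
  path_prod t a (rcons (mkseq v n) b).
Proof.
case: n => [|n]; first by move=> _ [].
move=> Xg gv q0; have nq : (0 < n.+1 * q)%N by rewrite muln_gt0.
rewrite -(prednK nq) !walk_end (walk_refine a Xg gv q0); last by rewrite ltn_predL.
(* The last fine cell has number (n+1)q - 1 and lies in the coarse cell n. *)
suff -> : ((n.+1 * q).-1 %/ q = n)%N by [].
apply/eqP; rewrite eqn_leq -ltnS ltn_divLR// ltn_predL nq leq_divRL//.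
by rewrite -ltnS prednK// ltn_mul2r q0 ltnSn.
Qed.

(** Both approximations are compared on the common refinement into n n' cells. *)
Lemma holonomy_unique g n v n' v' a b : (forall u, X (g u)) ->
  g 0 ord0 a != 0 -> g 1 ord0 b != 0 -> star_approx g n v -> star_approx g n' v' ->
  path_prod t a (rcons (mkseq v n) b) = path_prod t a (rcons (mkseq v' n') b).
Proof.
move=> Xg ga gb gv gv'; have [n0 _] := gv; have [n'0 _] := gv'.
rewrite -(holonomy_refine a b Xg gv n'0) -(holonomy_refine a b Xg gv' n0).
rewrite mulnC; apply: holonomy_same => //; last exact: approx_refine.
by rewrite mulnC; exact: approx_refine.
Qed.

(* Consecutive rows of a fine grid are subordinate to the same sequence of stars. *)
Lemma holonomy_homotopy (F : R -> R -> 'rV[R]_m) n v n' v' a b :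
  (forall i, continuous (fun su : R * R => F su.1 su.2 ord0 i)) ->
  (forall s u, X (F s u)) ->
  (forall s, F s 0 ord0 a != 0) -> (forall s, F s 1 ord0 b != 0) ->
  star_approx (F 0) n v -> star_approx (F 1) n' v' ->
  path_prod t a (rcons (mkseq v n) b) = path_prod t a (rcons (mkseq v' n') b).
Proof.
move=> cF XF Fa Fb Fv Fv'.
have [N [w [N0 wN]]] := grid_cover cF (fun s u => realization_nonzero (XF s u)).
have wl k : (k < N)%N -> star_approx (F (k%:R / N%:R)) N (w k).
  by move=> kN; split=> // l lN u ul; apply: wN => //; exact: cell_left.
have wr k : (k < N)%N -> star_approx (F (k.+1%:R / N%:R)) N (w k).
  by move=> kN; split=> // l lN u ul; apply: wN => //; exact: cell_right.
pose h k := path_prod t a (rcons (mkseq (w k) N) b).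
have hE k : (k < N)%N -> h k = h 0%N.
  elim: k => // k IHk kN; rewrite -IHk; last exact: ltnW.
  by apply: (@holonomy_unique (F (k.+1%:R / N%:R))) => //; [exact: wl|apply: wr; exact: ltnW].
transitivity (h 0%N).
  by apply: (@holonomy_unique (F 0)) => //; have := wl _ N0; rewrite mul0r.
rewrite -(hE N.-1) ?ltn_predL//; apply: (@holonomy_unique (F 1)) => //.
have := wr N.-1; rewrite ltn_predL N0 prednK// divff; last by rewrite pnatr_eq0 -lt0n.
by apply.
Qed.

(** A relation, so that any approximation may be used; [holonomy_unique] makes h unique for a curve
    in the realization from the star of a to the star of b. *)
Definition holonomy g a b h :=
  exists n v, star_approx g n v /\ h = path_prod t a (rcons (mkseq v n) b).

Lemma approx_gt0 g n v : star_approx g n v -> exists n', n = n'.+1.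
Proof. by move=> [n0 _]; exists n.-1; rewrite prednK. Qed.

Lemma holonomy_target g a b c h : (forall u, X (g u)) ->
  g 1 ord0 b != 0 -> g 1 ord0 c != 0 -> holonomy g a b h ->
  holonomy g a c (h *g t b c).
Proof.
move=> Xg gb gc [n [v [gv ->]]]; exists n, v; split=> //.
have [k nk] := approx_gt0 gv; rewrite nk in gv *.
by rewrite !walk_end -[LHS]mulgA (@transportM (g 1)) ?approx_last.
Qed.

(** Paths are extended by constants to the whole line, which keeps reparametrizations within real
    functions. *)
Definition curve x y g :=
  [/\ forall i, continuous (fun u => g u ord0 i), forall u, X (g u),
      forall u, u <= 0 -> g u = x & forall u, 1 <= u -> g u = y].

Definition cat_curve g g' u := if u <= 2^-1 then g (2 * u) else g' (2 * u - 1).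

Lemma cat_curveP x y z g g' : curve x y g -> curve y z g' -> curve x z (cat_curve g g').
Proof.
move=> [cg Xg g0 g1] [cg' Xg' g'0 g'1].
have c2 : continuous (fun u : R => 2 * u) by apply: ctsM; [exact: ctsC|move=> u; exact: cvg_id].
have c21 : continuous (fun u : R => 2 * u - 1) by apply: ctsB => //; exact: ctsC.
split=> [i|u|u u0|u u1]; rewrite /cat_curve.
- have := @paste_continuous R _ _ (fun u : R => u) (fun u => g (2 * u) ord0 i)
    (fun u => g' (2 * u - 1) ord0 i) 2^-1.
  have -> : (fun u => (if u <= 2^-1 then g (2 * u) else g' (2 * u - 1)) ord0 i) =
    (fun u => if u <= 2^-1 then g (2 * u) ord0 i else g' (2 * u - 1) ord0 i).
    by apply/funext => u; case: ifP.
  apply.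
  + by move=> u; exact: cvg_id.
  + exact: (cts_comp c2 (cg i)).
  + exact: (cts_comp c21 (cg' i)).
  + by move=> u ->; rewrite g1 ?g'0//; lra.
- by case: ifP.
- by rewrite ifT ?g0//; lra.
- by rewrite ifF ?g'1//; lra.
Qed.

Lemma cat_curve_approx x y z g g' n v v' : curve x y g -> curve y z g' ->
  star_approx g n v -> star_approx g' n v' ->
  star_approx (cat_curve g g') (n + n) (fun k => if (k < n)%N then v k else v' (k - n)%N).
Proof.
move=> [_ _ _ g1] [_ _ g'0 _] [n0 gv] [_ gv'].
split=> [|k kn u]; first by rewrite addn_gt0 n0.
have n0R : (0 : R) < n%:R by rewrite ltr0n.
have E : (n + n)%:R = n%:R * 2 :> R by rewrite natrD mulr_natr mulr2n.
rewrite E invfM mulrA [in X in _ <= _ <= X]mulrA => /andP[ku uk].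
rewrite /cat_curve; case: (ltnP k n) => nk.
  have kn1 : k.+1%:R / n%:R <= 1 :> R by rewrite ler_pdivrMr// mul1r ler_nat.
  by rewrite ifT; [apply: gv => //; lra|lra].
have kE : k%:R / n%:R = (k - n)%:R / n%:R + 1 :> R.
  by rewrite natrB// mulrBl divff ?subrK// gt_eqF.
have kSE : k.+1%:R / n%:R = (k - n).+1%:R / n%:R + 1 :> R.
  by rewrite -subSn// natrB ?leqW// mulrBl divff ?subrK// gt_eqF.
have knn : (k - n < n)%N by rewrite ltn_subLR.
have kn0 : 0 <= (k - n)%:R / n%:R :> R by rewrite divr_ge0.
case: (leP u 2^-1) => u2; last by apply: gv' => //; lra.
(* A cell of the second half meets u <= 1/2 only in u = 1/2, where both pieces take the value y. *)
have -> : g (2 * u) = g' (2 * u - 1) by rewrite g1 ?g'0//; lra.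
by apply: gv' => //; lra.
Qed.

(** After refinement to equally many cells the approximations are juxtaposed. The junction y lies in
    the stars of b and of both adjacent vertices, so the passage through b changes nothing. *)
Lemma holonomy_cat x y z g g' a b c h h' : curve x y g -> curve y z g' ->
  y ord0 b != 0 -> holonomy g a b h -> holonomy g' b c h' ->
  holonomy (cat_curve g g') a c (h *g h').
Proof.
move=> cg cg' yb [n [v [gv ->]]] [n' [v' [gv' ->]]].
have [[_ Xg _ g1] [_ Xg' g'0 _]] := (cg, cg').
have [[n0 _] [n'0 _]] := (gv, gv').
rewrite -(holonomy_refine a b Xg gv n'0) -(holonomy_refine b c Xg' gv' n0).
have gw := approx_refine n'0 gv; have := approx_refine n0 gv'.
rewrite [(n' * n)%N]mulnC => gw'; move: gw gw'.
move: (fun k => v (k %/ n')%N) (fun k => v' (k %/ n)%N) (n * n')%N => w w' N gw gw'.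
exists (N + N)%N, (fun k => if (k < N)%N then w k else w' (k - N)%N); split.
  exact: cat_curve_approx cg cg' gw gw'.
have -> : mkseq (fun k => if (k < N)%N then w k else w' (k - N)%N) (N + N) =
    mkseq w N ++ mkseq w' N.
  rewrite /mkseq iotaD map_cat; congr (_ ++ _).
    by apply/eq_in_map => k; rewrite mem_iota => /= ->.
  rewrite add0n -[X in iota X]addn0 iotaDl -map_comp; apply: eq_map => k /=.
  by rewrite ltnNge leq_addr addKn.
have [M NM] := approx_gt0 gw; rewrite NM in gw gw' *.
rewrite rcons_cat path_prod_cat last_mkseq path_prod_rcons last_mkseq -mulgA.
congr (_ *g _).
have gy : g 1 = y by rewrite g1.
have g'y : g' 0 = y by rewrite g'0.
have := approx_last gw; have := approx_left gw' (ltn0Sn _); rewrite mul0r gy g'y => yw' yw.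
rewrite /mkseq /= mulgA; congr (_ *g _).
by rewrite (@transportM y)// -gy.
Qed.

Definition segment x y (u : R) : 'rV[R]_m :=
  (1 - Num.max 0 (Num.min 1 u)) *: x + Num.max 0 (Num.min 1 u) *: y.

Lemma segmentP x y : X x -> X y ->
  ([set i | x ord0 i != 0] :|: [set i | y ord0 i != 0])%SET \in full_subcomplex K J ->
  curve x y (segment x y).
Proof.
move=> [x0 x1 xK] [y0 y1 yK] xyK.
have c01 (u : R) : 0 <= (Num.max 0 (Num.min 1 u) : R) <= 1.
  by rewrite le_max lexx ge_max ler01 ge_min lexx.
split=> [i|u|u u0|u u1].
- under eq_fun do rewrite !mxE.
  have cc : continuous (fun u : R => Num.max 0 (Num.min 1 u)).
    exact: (cts_comp (@clamp_continuous R) (@val_continuous R)).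
  apply: ctsD; apply: ctsM; [|exact: ctsC|exact: cc|exact: ctsC].
  by apply: ctsB; [exact: ctsC|exact: cc].
- have /andP[c0 c1] := c01 u; rewrite /segment; move: (Num.max _ _) c0 c1 => c c0 c1.
  split=> [i||].
  + by rewrite !mxE addr_ge0// mulr_ge0// subr_ge0.
  + under eq_bigr do rewrite !mxE.
    by rewrite big_split /= -!mulr_sumr x1 y1 !mulr1 subrK.
  + move: xyK; rewrite !inE => /andP[xyK xyJ].
    have sub : [set i | ((1 - c) *: x + c *: y) ord0 i != 0]%SET \subset
        ([set i | x ord0 i != 0] :|: [set i | y ord0 i != 0])%SET.
      apply/fintype.subsetP => i; rewrite !inE !mxE; apply: contraNT.
      by rewrite negb_or !negbK => /andP[/eqP -> /eqP ->]; rewrite !mulr0 addr0.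
    have [_ _ Kdown] := K_complex.
    by rewrite (Kdown _ _ xyK sub) (fintype.subset_trans sub xyJ).
- by rewrite /segment max_l ?ge_min ?u0 ?orbT// subr0 scale1r scale0r addr0.
- by rewrite /segment min_l// max_r// subrr scale0r add0r scale1r.
Qed.

(** One cell suffices, because the coordinate at a stays positive on the whole segment. *)
Lemma segment_holonomy x y a : X x -> X y -> x ord0 a != 0 -> y ord0 a != 0 ->
  holonomy (segment x y) a a 1%g.
Proof.
move=> Xx Xy xa ya; exists 1%N, (fun=> a); split; last first.
  by rewrite /= (transport1 Xx xa) !mulg1.
split=> // k _ u _; have [[x0 _ _] [y0 _ _]] := (Xx, Xy).
rewrite /segment !mxE; set c := Num.max _ _.
have /andP[c0 c1] : 0 <= c <= 1 by rewrite le_max lexx ge_max ler01 ge_min lexx.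
have xa0 : 0 < x ord0 a by rewrite lt_neqAle eq_sym xa x0.
have ya0 : 0 < y ord0 a by rewrite lt_neqAle eq_sym ya y0.
have [->|cn0] := eqVneq c 0; first by rewrite subr0 mul1r mul0r addr0.
have {}c0 : 0 < c by rewrite lt_neqAle eq_sym cn0.
by rewrite gt_eqF// ltr_wpDl ?mulr_gt0// mulr_ge0 ?subr_ge0.
Qed.

(** The case a = b is used as well: [midpoint a a] is the vertex a of the realization. *)
Definition midpoint a b : 'rV[R]_m := 2^-1 *: (delta_mx ord0 a + delta_mx ord0 b).

Lemma midpoint_neq0 a b i : (midpoint a b ord0 i != 0) = (i \in [set a; b]%SET).
Proof.
rewrite !mxE eqxx /= mulf_eq0 invr_eq0 pnatr_eq0 /= -natrD pnatr_eq0 !inE.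
by case: (i == a); case: (i == b).
Qed.

Lemma midpoint_realization a b : edge K J a b -> X (midpoint a b).
Proof.
move=> /and3P[aJ bJ abK]; split=> [i||].
- by rewrite !mxE mulr_ge0// ?invr_ge0// addr_ge0.
- under eq_bigr do rewrite !mxE eqxx /=.
  have s1 c : \sum_(i < m) (i == c)%:R = 1 :> R.
    by rewrite (bigD1 c)//= eqxx big1 ?addr0// => i /negbTE->.
  by rewrite -mulr_sumr big_split /= !s1 -[1 + 1]/(2%:R) mulVf// pnatr_eq0.
- have -> : [set i | midpoint a b ord0 i != 0]%SET = [set a; b]%SET.
    by apply/setP => i; rewrite !inE midpoint_neq0 !inE.
  rewrite inE abK /=; apply/fintype.subsetP => i.
  by rewrite !inE => /orP[]/eqP->.
Qed.

Lemma vertex_edge a : a \in J -> edge K J a a.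
Proof. by have [_ K1 _] := K_complex => aJ; rewrite /edge aJ finset.setUid K1. Qed.

(** The supports of x and y need not span a common face, so the segment between them may leave the
    realization; the detour through the vertex a stays inside. *)
Lemma star_curve x y a : X x -> X y -> x ord0 a != 0 -> y ord0 a != 0 ->
  exists g, curve x y g /\ holonomy g a a 1%g.
Proof.
move=> Xx Xy xa ya; pose e := midpoint a a.
have eaa := realization_edge Xx xa xa; have Xe := midpoint_realization eaa.
have ea : e ord0 a != 0 by rewrite midpoint_neq0 !inE eqxx.
have sub z : X z -> z ord0 a != 0 ->
    ([set i | z ord0 i != 0] :|: [set i | e ord0 i != 0])%SET \in full_subcomplex K J.
  move=> [_ _ zK] za.
  suff -> : ([set i | z ord0 i != 0] :|: [set i | e ord0 i != 0])%SET =
    [set i | z ord0 i != 0]%SET by [].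
  apply/finset.setUidPl/fintype.subsetP => i.
  by rewrite !inE midpoint_neq0 !inE orbb => /eqP ->.
have c1 : curve x e (segment x e) by apply: segmentP => //; exact: sub.
have c2 : curve e y (segment e y) by apply: segmentP => //; rewrite finset.setUC; exact: sub.
exists (cat_curve (segment x e) (segment e y)); split; first exact: cat_curveP c1 c2.
rewrite -(mulg1 1%g); apply: (holonomy_cat c1 c2 ea); exact: segment_holonomy.
Qed.

(** The curve visits the midpoints of the edges, each of which lies in the stars of both ends. *)
Lemma realize_path a s x y : path (edge K J) a s -> X x -> X y ->
  x ord0 a != 0 -> y ord0 (last a s) != 0 ->
  exists g, curve x y g /\ holonomy g a (last a s) (path_prod t a s).
Proof.
elim: s a x => [|b s IHs] a x /= => [_|/andP[ab ps]] Xx Xy xa ya.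
  exact: star_curve.
have Xz := midpoint_realization ab.
have za : midpoint a b ord0 a != 0 by rewrite midpoint_neq0 !inE eqxx.
have zb : midpoint a b ord0 b != 0 by rewrite midpoint_neq0 !inE eqxx orbT.
have [g [cg hg]] := star_curve Xx Xz xa za.
have [g' [cg' hg']] := IHs b _ ps Xz Xy zb ya.
exists (cat_curve g g'); split; first exact: cat_curveP cg cg'.
(* The first piece has holonomy 1 with target a; its end is the midpoint, where the target may be
   changed to b at the price of [t a b]. *)
apply: (holonomy_cat cg cg' zb) => //; rewrite -[t a b]mul1g.
have [_ Xg _ g1] := cg.
by apply: holonomy_target => //; rewrite g1.
Qed.

End Transport.

Implicit Type g : R -> 'rV[R]_m.

(** Consecutive cells share an end point, which lies in the stars of both vertices. *)
Lemma approx_path g n v a b : (forall u, X (g u)) -> star_approx g n v ->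
  g 0 ord0 a != 0 -> g 1 ord0 b != 0 -> path (edge K J) a (rcons (mkseq v n) b).
Proof.
move=> Xg gv ga gb; have [k nk] := approx_gt0 gv; rewrite nk in gv *.
rewrite rcons_path last_mkseq (realization_edge (Xg 1)) ?approx_last// andbT.
suff H j : (j < k.+1)%N -> path (edge K J) a (mkseq v j.+1) by exact: H.
elim: j => [|j IHj] jk.
  rewrite /= andbT (realization_edge (Xg 0))//.
  by have := approx_left gv jk; rewrite mul0r.
rewrite mkseqS rcons_path last_mkseq IHj 1?ltnW//=.
apply: (realization_edge (Xg (j.+1%:R / k.+1%:R))); last exact: approx_left.
by apply: approx_right => //; exact: ltnW.
Qed.

Local Notation T := (full_realization R K J).

Lemma coord_val_continuous i : continuous (fun x : T => \val x ord0 i).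
Proof.
apply: (@cts_comp _ _ _ (\val : T -> _) (fun x : 'rV[R]_m => x ord0 i)).
  exact: initial_continuous.
exact: coord_continuous.
Qed.

Lemma curve_coord_continuous g : (forall i, continuous (fun u => g u ord0 i)) ->
  continuous g.
Proof.
move=> cg u A [P uP PA].
have : \forall w \near u, forall i, P ord0 i (g w ord0 i).
  apply: (@filter_forall R 'I_m (fun i w => P ord0 i (g w ord0 i)) (nbhs u) _ _).
  by move=> i; exact: (cg i u _ (uP ord0 i)).
apply: filterS => w Pw; apply: PA => i j; rewrite (ord1 i); exact: Pw.
Qed.

Lemma path_componentP (x y : T) :
  path_component R x y <-> exists g, curve (\val x) (\val y) g.
Proof.
split=> [[p]|[g [cg Xg g0 g1]]].
  exists (fun u => \val (p (clamp u))); split=> [i|u|u u0|u u1].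
  - exact: (cts_comp (@clamp_continuous R)
      (cts_comp (@cts_fun _ _ p) (@coord_val_continuous i))).
  - exact: set_valP.
  - by rewrite clamp_le0// path_zero.
  - by rewrite clamp_ge1// path_one.
pose p (s : unit_itv R) : T := exist _ (g (\val s)) (mem_set (Xg _)).
have cp : continuous p.
  apply: continuous_comp_initial.
  exact: (cts_comp (@val_continuous R) (curve_coord_continuous cg)).
have p0 : p zero = x.
  by apply/val_inj; exact: (etrans (congr1 g (@val_zero R)) (g0 _ (lexx _))).
have p1 : p one = y.
  by apply/val_inj; exact: (etrans (congr1 g (@val_one R)) (g1 _ (lexx _))).
by squash (mk_path cp p0 p1 : {path unit_itv R from x to y in T}).
Qed.

End Holonomy.

(** * Loops generating the combinatorial fundamental groups *)

Section LoopHolonomy.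
Variables (R : realType) (m : nat) (K : {set {set 'I_m}}).
Hypothesis K_complex : simplicial_complex K.
Variable J : {set 'I_m}.
Local Open Scope classical_set_scope.
Local Open Scope ring_scope.
Local Open Scope quotient_scope.
Local Notation X := (realization R (full_subcomplex K J)).
Local Notation T := (full_realization R K J).

Section Component.
Variable C : path_components R T.
Local Notation x0 := (base_point C).
Local Notation loop := {path unit_itv R from x0 to x0 in (\val C)}.

Definition loop_curve (p : loop) : R -> 'rV[R]_m := fun u => \val (\val (p (clamp u))).

Lemma coord_component_continuous i : continuous (fun x : \val C => \val (\val x) ord0 i).
Proof.
apply: (@cts_comp _ _ _ (\val : \val C -> T) (fun x : T => \val x ord0 i)).
  exact: initial_continuous.
exact: coord_val_continuous.
Qed.

Lemma loop_curveP (p : loop) : curve K J (\val (\val x0)) (\val (\val x0)) (loop_curve p).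
Proof.
split=> [i|u|u u0|u u1]; rewrite /loop_curve.
- exact: (cts_comp (@clamp_continuous R)
    (cts_comp (@cts_fun _ _ p) (@coord_component_continuous i))).
- exact: set_valP.
- by rewrite clamp_le0// path_zero.
- by rewrite clamp_ge1// path_one.
Qed.

Lemma base_vertex_exists : exists i, \val (\val x0) ord0 i != 0.
Proof. apply: (@realization_nonzero R m K J); exact: set_valP. Qed.

Definition base_vertex : 'I_m := sval (cid base_vertex_exists).

Lemma base_vertexP : \val (\val x0) ord0 base_vertex != 0.
Proof. exact: svalP (cid base_vertex_exists). Qed.

Lemma loop_approx (p : loop) :
  exists nv : nat * (nat -> 'I_m), star_approx (loop_curve p) nv.1 nv.2.
Proof.
have [cg Xg _ _] := loop_curveP p.
have [n [v gv]] := path_approx cg (fun u => realization_nonzero (Xg u)).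
by exists (n, v).
Qed.

(** Depends on a chosen representative and a chosen approximation; its transport under a functor
    does not, by [holonomy_class]. *)
Definition edge_loop (x : pi1 R x0) : seq 'I_m :=
  let nv := sval (cid (loop_approx (repr x))) in
  base_vertex :: rcons (mkseq nv.2 nv.1) base_vertex.

Lemma loop_curve0 (p : loop) : loop_curve p 0 ord0 base_vertex != 0.
Proof. by have [_ _ -> // _] := loop_curveP p; exact: base_vertexP. Qed.

Lemma loop_curve1 (p : loop) : loop_curve p 1 ord0 base_vertex != 0.
Proof. by have [_ _ _ ->//] := loop_curveP p; exact: base_vertexP. Qed.

Lemma edge_loop_closed x : closed_path K J (edge_loop x).
Proof.
rewrite /edge_loop /=; set nv := sval (cid _).
have nvP : star_approx (loop_curve (repr x)) nv.1 nv.2 := svalP (cid (loop_approx (repr x))).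
rewrite last_rcons eqxx andbT; have [_ Xg _ _] := loop_curveP (repr x).
by apply: (approx_path K_complex Xg nvP); [exact: loop_curve0|exact: loop_curve1].
Qed.

Section Transport.
Variables (G : groupType) (t : 'I_m -> 'I_m -> G).
Hypothesis tF : functorial K J t.

Lemma edge_loop_holonomy x :
  holonomy t (loop_curve (repr x)) base_vertex base_vertex (loop_prod t (edge_loop x)).
Proof.
rewrite /edge_loop /=; set nv := sval (cid _); exists nv.1, nv.2; split=> //.
exact: svalP (cid (loop_approx (repr x))).
Qed.

(** The homotopy from the chosen representative of the class to p preserves holonomy. *)
Lemma holonomy_class (p : loop) h : holonomy t (loop_curve p) base_vertex base_vertex h ->
  loop_prod t (edge_loop (\pi_(pi1 R x0) p)) = h.
Proof.
move=> [n' [v' [pv' ->]]].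
have [n [v [pv ->]]] := edge_loop_holonomy (\pi_(pi1 R x0) p).
have [H [cH H0 H1 Hx Hy]] := homotopic_repr p.
pose F (s u : R) : 'rV[R]_m := \val (\val (H (clamp s, clamp u))).
have F0 : F 0 = loop_curve (repr (\pi_(pi1 R x0) p)).
  by apply/funext => u; rewrite /F clamp_le0// H0.
have F1 : F 1 = loop_curve p by apply/funext => u; rewrite /F clamp_ge1// H1.
rewrite -F0 in pv; rewrite -F1 in pv'.
apply: (holonomy_homotopy K_complex tF _ _ _ _ pv pv').
- move=> i; apply: (cts_comp _ (@coord_component_continuous i)).
  apply: (cts_comp _ cH) => su.
  apply: (@cvg_pair _ _ _ (nbhs su) (nbhs (clamp su.1)) (nbhs (clamp su.2))).
    by apply: (@continuous_comp _ _ _ fst); [exact: fst_continuous|exact: clamp_continuous].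
  by apply: (@continuous_comp _ _ _ snd); [exact: snd_continuous|exact: clamp_continuous].
- by move=> s u; exact: set_valP.
- by move=> s; rewrite /F (clamp_le0 (lexx 0)) Hx; exact: base_vertexP.
- by move=> s; rewrite /F (clamp_ge1 (lexx 1)) Hy; exact: base_vertexP.
Qed.

Lemma loop_curve_concat (p q : loop) :
  loop_curve (concat_loop p q) = cat_curve (loop_curve p) (loop_curve q).
Proof.
apply/funext => u; rewrite /loop_curve /cat_curve.
rewrite -[concat_loop p q (clamp u)]/(concat p q (clamp u)) /concat.
have [u0|u0] := leP u 0.
  rewrite (clamp_le0 u0) val_zero ifT; last by lra.
  by rewrite ifT; [rewrite !clamp_le0//; lra|lra].
have [u1|u1] := leP 1 u.
  rewrite (clamp_ge1 u1) val_one ifF; last by lra.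
  by rewrite ifF; [rewrite !clamp_ge1//; lra|lra].
by rewrite val_clamp; [case: ifP|lra].
Qed.

Lemma edge_loopM x y :
  loop_prod t (edge_loop (x * y)%g) =
  (loop_prod t (edge_loop x) * loop_prod t (edge_loop y))%g.
Proof.
apply: holonomy_class; rewrite loop_curve_concat.
apply: (holonomy_cat K_complex tF (loop_curveP _) (loop_curveP _) base_vertexP);
  exact: edge_loop_holonomy.
Qed.
End Transport.
End Component.

Lemma curve_between_components (x y : T) a b :
  \val x ord0 a != 0 -> \val y ord0 b != 0 -> path_component R x y ->
  exists s, path (edge K J) a s /\ last a s = b.
Proof.
move=> xa yb /path_componentP[g [cg Xg g0 g1]].
have [n [v gv]] := path_approx cg (fun u => realization_nonzero (Xg u)).
exists (rcons (mkseq v n) b); rewrite last_rcons; split=> //.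
by apply: (approx_path K_complex Xg gv); [rewrite g0|rewrite g1].
Qed.

(** Used to see that a curve never leaves the path component of its origin. *)
Lemma subcurve (x y : 'rV[R]_m) g (r : R) : curve K J x y g -> 0 <= r -> curve K J x (g r)
  (fun u => g (r * Num.max 0 (Num.min 1 u))).
Proof.
move=> [cg Xg g0 g1] r0; split=> [i|u|u u0|u u1].
- have cc : continuous (fun u : R => Num.max 0 (Num.min 1 u)).
    exact: (cts_comp (@clamp_continuous R) (@val_continuous R)).
  apply: (@cts_comp _ _ _ (fun u : R => r * Num.max 0 (Num.min 1 u))
    (fun u => g u ord0 i)) => //.
  by apply: ctsM; [exact: ctsC|exact: cc].
- exact: Xg.
- by rewrite max_l ?ge_min ?u0 ?orbT// mulr0 g0.
- by rewrite min_l// max_r// mulr1.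
Qed.

(** The loop must live in the subspace C: the piece of g up to time s joins the base point to
    [g s]. *)
Lemma curve_loop (C : path_components R T) g :
  curve K J (\val (\val (base_point C))) (\val (\val (base_point C))) g ->
  exists p, g = loop_curve (C := C) p.
Proof.
set x0 := base_point C => cg; have [cc Xg g0 g1] := cg.
pose q (s : unit_itv R) : T := exist _ (g (\val s)) (mem_set (Xg _)).
have qC s : (\val C : set T) (q s).
  have /asboolP[z Cz] := valP C; rewrite Cz.
  have : path_component R z (\val x0) by rewrite -Cz; exact: set_valP.
  move=> /path_componentP[h hc]; apply/path_componentP.
  have /andP[s0 _] := unit_itvP s.
  by eexists; exact: (cat_curveP hc (subcurve cg s0)).
pose p (s : unit_itv R) : \val C := exist _ (q s) (mem_set (qC s)).
have cp : continuous p.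
  apply: continuous_comp_initial; apply: continuous_comp_initial.
  exact: (cts_comp (@val_continuous R) (curve_coord_continuous cc)).
have p0 : p zero = x0.
  by do 2 apply/val_inj; exact: (etrans (congr1 g (@val_zero R)) (g0 _ (lexx _))).
have p1 : p one = x0.
  by do 2 apply/val_inj; exact: (etrans (congr1 g (@val_one R)) (g1 _ (lexx _))).
exists (mk_path cp p0 p1); apply/funext => u.
change (g u = g (\val (clamp u))).
have [u0|u0] := leP u 0; first by rewrite clamp_le0// val_zero !g0.
have [u1|u1] := leP 1 u; first by rewrite clamp_ge1// val_one !g1.
by rewrite val_clamp//; lra.
Qed.

Section Generation.
Variables (G : groupType) (t : 'I_m -> 'I_m -> G).
Hypothesis tF : functorial K J t.

(** Both paths are completed by the same ends to closed edge paths at the base vertex. These are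
    holonomies of genuine loops, hence trivial, and the common ends cancel. *)
Lemma loops_generate :
  (forall C (x : pi1 R (base_point C)), loop_prod t (edge_loop x) = 1%g) ->
  forall a s s', path (edge K J) a s -> path (edge K J) a s' -> last a s = last a s' ->
  path_prod t a s = path_prod t a s'.
Proof.
move=> t1 a s s' ps ps' ss'.
have [aJ|aJ] := boolP (a \in J); last first.
  have nil r : path (edge K J) a r -> r = [::].
    by case: r => //= b r /andP[/and3P[aJ' _ _] _]; rewrite aJ' in aJ.
  by rewrite (nil _ ps) (nil _ ps').
pose b := last a s.
have Xa := midpoint_realization R (vertex_edge K_complex aJ).
pose ea : T := exist _ (midpoint R a a) (mem_set Xa).
pose C : path_components R T :=
  exist _ (path_component R ea) (asboolT (ex_intro _ ea erefl)).
have eaa : \val ea ord0 a != 0 by rewrite midpoint_neq0 !inE eqxx.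
have Cx0 : path_component R ea (\val (base_point C)) by exact: (set_valP (base_point C)).
have [s0 [ps0 ls0]] := curve_between_components eaa (base_vertexP C) Cx0.
have c0 : connect (edge K J) a (base_vertex C) by apply/connectP; exists s0.
have /connectP[s1 ps1 ls1] : connect (edge K J) (base_vertex C) a.
  by rewrite edge_connect_sym.
have /connectP[s2 ps2 ls2] : connect (edge K J) b (base_vertex C).
  by apply: connect_trans c0; rewrite edge_connect_sym; apply/connectP; exists s.
(* Here s1 leads from the base vertex to a, and s2 from the common end b back to the base vertex. *)
have trivial r : path (edge K J) a r -> last a r = b ->
    path_prod t (base_vertex C) (s1 ++ r ++ s2) = 1%g.
  move=> pr lr; have pp : path (edge K J) (base_vertex C) (s1 ++ r ++ s2).
    by rewrite !cat_path ps1 -ls1 pr lr ps2.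
  have lp : last (base_vertex C) (s1 ++ r ++ s2) = base_vertex C.
    by rewrite !last_cat -ls1 lr.
  have Xx0 := set_valP (\val (base_point C)).
  have [|g [cg hg]] := realize_path K_complex tF pp Xx0 Xx0 (base_vertexP C).
    by rewrite lp; exact: base_vertexP.
  rewrite lp in hg; have [p gp] := curve_loop cg.
  by rewrite gp in hg; rewrite -(holonomy_class tF hg) t1.
apply: (mulgI (path_prod t (base_vertex C) s1)).
apply: (mulIg (path_prod t b s2)).
have := trivial s ps erefl; have := trivial s' ps' (esym ss').
by rewrite !path_prod_cat -ls1 -ss' -/b !mulgA => -> ->.
Qed.
End Generation.

Section Presentation.
Variables (Y Z : choiceType) (r : Z -> word Y).
Hypothesis rP : presents r (Pi1 R T).

(* The generators may mix several factors of the free product, so each of them is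
   a word of loops, possibly based in different components. *)
Lemma loops_of_presentation : exists loops : Y -> word (seq 'I_m),
  (forall y s b, (s, b) \in loops y -> closed_path K J s) /\
  forall (G : groupType) (t : 'I_m -> 'I_m -> G), functorial K J t ->
    (forall y, weval (loop_prod t) (loops y) = 1%g) ->
    forall a s s', path (edge K J) a s -> path (edge K J) a s' -> last a s = last a s' ->
    path_prod t a s = path_prod t a s'.
Proof.
have [f [f' fK f'K]] := rP.
pose el (z : {C : path_components R T & pi1 R (base_point C)}) := edge_loop (tagged z).
pose gen y : Pi1 R T := f (wclass _ [:: (y, true)]).
exists (fun y => [seq (el l.1, l.2) | l <- repr (gen y)]); split.
  by move=> y s b /mapP[l _ [-> _]]; exact: edge_loop_closed.
move=> G t tF t1; apply: (loops_generate tF) => C x.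
pose phi z := loop_prod t (el z).
have phi_rel w : free_product_rel (fun C : path_components R T => pi1 R (base_point C)) w ->
    weval phi w = 1%g.
  case=> i [g [h ->]]; rewrite !weval_cons weval_nil /= mulg1 mulgA.
  change (loop_prod t (edge_loop g) * loop_prod t (edge_loop h) *
    (loop_prod t (edge_loop (g * h)))^-1 = 1)%g.
  by rewrite edge_loopM// mulgV.
(* Holonomy is a homomorphism on [Pi_1]; it kills the generators of the presentation, hence is
   trivial. *)
pose Phi : {multiplicative Pi1 R T -> G} := pgroup_lift phi_rel.
have Phi_gen y : Phi (gen y) = 1%g.
  rewrite -(t1 y); rewrite [LHS]/(weval phi (repr (gen y))) /phi.
  by rewrite /weval big_map.
have PhiE w : Phi (wclass _ w) = weval phi w := wclass_lift phi_rel w.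
pose z : {C : path_components R T & pi1 R (base_point C)} :=
  existT _ C x.
have -> : loop_prod t (edge_loop x) = Phi (wclass _ [:: (z, true)]).
  by rewrite PhiE weval_cons weval_nil mulg1.
rewrite -[wclass _ _]f'K; have [w ->] := wclassP (f' (wclass _ [:: (z, true)])).
rewrite wclass_weval weval_morph weval_morph.
by apply: weval_eq1 => y b _; exact: Phi_gen.
Qed.
End Presentation.
End LoopHolonomy.

(** * Ranks and loops indexed by them *)

Section RankCases.
Variable R : realType.
Local Open Scope classical_set_scope.
Local Open Scope ereal_scope.

Lemma counting_finite (T : choiceType) n : counting [set: T] = n%:R%:E :> \bar R ->
  exists2 s : seq T, size s = n & forall x, x \in s.
Proof.
rewrite /counting; case: asboolP => // fT /eqP; rewrite eqe eqr_nat => /eqP sT.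
by exists (enum_fset (fset_set [set: T])) => // x; rewrite in_fset_set// in_setT.
Qed.

Lemma counting_nat (T : choiceType) (A : set T) :
  counting A = +oo :> \bar R \/ exists n, counting A = n%:R%:E :> \bar R.
Proof. by rewrite /counting; case: ifP => _; [right; eexists|left]. Qed.

Lemma counting_ge0 (T : choiceType) (A : set T) : 0 <= counting A :> \bar R.
Proof. by have [->|[n ->]] := counting_nat A; rewrite ?leey// lee_fin. Qed.

(** By well-ordering a finite infimum is attained, so a finite rank comes with an actual
    presentation. *)
Lemma ereal_inf_nat (S : set (\bar R)) :
  (forall x, S x -> x = +oo \/ exists n, x = n%:R%:E) ->
  ereal_inf S = +oo \/ exists n, ereal_inf S = n%:R%:E /\ S n%:R%:E.
Proof.
move=> SP; have [[n Sn]|S0] := pselect (exists n, S n%:R%:E); last first.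
  left; apply/eqP; rewrite -leye_eq; apply: le_ereal_inf_tmp => x Sx.
  by case: (SP x Sx) => [->//|[n xn]]; case: S0; exists n; rewrite -xn.
have [n0 Sn0 n0min] := ex_minnP (ex_intro (fun n => `[< S n%:R%:E >]) n (asboolT Sn)).
right; exists n0; have {}Sn0 := asboolW Sn0; split=> //.
apply/eqP; rewrite eq_le; apply/andP; split; first exact: ereal_inf_lbound.
apply: le_ereal_inf_tmp => x Sx; case: (SP x Sx) => [->|[k xk]]; first exact: leey.
by rewrite xk lee_fin ler_nat n0min//; apply/asboolP; rewrite -xk.
Qed.

Lemma grank_nat (G : groupType) :
  grank R G = +oo \/ exists n, grank R G = n%:R%:E /\
    exists (Y Z : choiceType) (r : Z -> word Y),
      presents r G /\ counting [set: Y] = n%:R%:E :> \bar R.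
Proof.
rewrite /grank; have [|->|[n [-> [Y [Z [r [rP rn]]]]]]] := @ereal_inf_nat
  [set x | exists (X Y : choiceType) (r : Y -> word X), presents r G /\ x = counting [set: X]].
- by move=> _ [Y [Z [r [_ ->]]]]; exact: counting_nat.
- by left.
- by right; exists n; split=> //; exists Y, Z, r.
Qed.

Lemma lt_below n k : (k%:R%:E < n%:R%:E :> \bar R) = (k < n)%N.
Proof. by rewrite lte_fin ltr_nat. Qed.
End RankCases.

Section Loops.
Variables (R : realType) (m : nat) (K : {set {set 'I_m}}).
Hypothesis K_complex : simplicial_complex K.
Variable J : {set 'I_m}.
Local Open Scope group_scope.

(** For finite rank the generators of a minimal presentation give the loops; for infinite rank the
    closed edge paths, being countably many, are all listed. *)
Lemma loops_of_rank : exists loops : below (rk R K J) -> word (seq 'I_m),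
  (forall k s b, (s, b) \in loops k -> closed_path K J s) /\
  forall (G : groupType) (t : 'I_m -> 'I_m -> G), functorial K J t ->
    (forall k, weval (loop_prod t) (loops k) = 1) ->
    forall a s s', path (edge K J) a s -> path (edge K J) a s' -> last a s = last a s' ->
    path_prod t a s = path_prod t a s'.
Proof.
rewrite /rk; have := grank_nat R (Pi1 R (full_realization R K J)).
move=> [->|[n [-> [Y [Z [r [rP Yn]]]]]]].
  (* below +oo is all of nat, which has room for all closed edge paths. *)
  pose lp k : word (seq 'I_m) :=
    if choice.unpickle k is Some s then if closed_path K J s then [:: (s, true)] else [::] else [::].
  exists (fun k => lp (val k)); split=> [k s b|G t tF t1 a s s' ps ps' ss'].
    rewrite /lp; case: choice.unpickle => //= s'; case: ifP => // cs'.
    by rewrite inE => /eqP[-> _].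
  have closed1 u : closed_path K J u -> loop_prod t u = 1.
    move=> cu; have := t1 (exist _ (choice.pickle u) (ltry _)).
    by rewrite -[val _]/(choice.pickle u) /lp choice.pickleK cu weval_cons weval_nil mulg1.
  have /connectP[s2 ps2 ls2] : connect (edge K J) (last a s) a.
    by rewrite edge_connect_sym; apply/connectP; exists s.
  have pc r : path (edge K J) a r -> last a r = last a s -> path_prod t a (r ++ s2) = 1.
    move=> pr lr; apply: (closed1 (a :: (r ++ s2))).
    by rewrite /= cat_path last_cat pr lr ps2 -ls2 eqxx.
  apply: (mulIg (path_prod t (last a s) s2)).
  have := pc s ps erefl; have := pc s' ps' (esym ss').
  by rewrite !path_prod_cat -ss' => -> ->.
have [loops [cl gl]] := loops_of_presentation K_complex rP.
have [e en eY] := counting_finite Yn.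
(* The k-th loop word belongs to the k-th generator in the enumeration e. *)
exists (fun k => nth [::] [seq loops y | y <- e] (val k)); split=> [k s b|G t tF t1].
  have [ke|ke] := ltnP (val k) (size [seq loops y | y <- e]); last by rewrite nth_default.
  by have /mapP[y _ ->] := mem_nth [::] ke; exact: cl.
apply: (gl _ _ tF) => y.
have kn : (((index y e)%:R : R)%:E < n%:R%:E)%E by rewrite lt_below -en index_mem.
have := t1 (exist _ (index y e) kn).
by rewrite /= (nth_map y) ?index_mem// nth_index.
Qed.
End Loops.

(** * Reduced Betti numbers *)

Section WeightedSum.
Variable T : choiceType.
Local Open Scope classical_set_scope.
Local Open Scope ring_scope.
Implicit Types (c d : T -> rat^o) (f : T -> rat).

Definition fin_supp c := exists s : {fset T}, forall x, x \notin s -> c x = 0.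

(** The pairing of a weight with a 0-chain; indicator weights give the mass of a component, the
    weight 1 the augmentation. *)
Definition wsum f c : rat := \sum_(x \in [set: T]) f x * c x.

Lemma wsum1 c : wsum (fun=> 1) c = \sum_(x \in [set: T]) c x.
Proof.
have e : (fun x => 1 * c x) = c by apply/funext => x; exact: mul1r.
exact: (congr1 (fun d : T -> rat => \sum_(x \in [set: T]) d x) e).
Qed.

Lemma wsumE (s : {fset T}) f c : (forall x, x \notin s -> c x = 0) ->
  wsum f c = \sum_(x <- s) f x * c x.
Proof. by move=> sc; apply: fsbigTE => x /sc ->; rewrite mulr0. Qed.

Lemma fin_suppP c : finite_set [set x | c x != 0] -> fin_supp c.
Proof.
move=> fc; exists (fset_set [set x | c x != 0]) => x; rewrite in_fset_set// => xc.
by apply/eqP; apply: contraNT xc => x0; exact: mem_set.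
Qed.

Lemma finite_fin_supp c : fin_supp c -> finite_set [set x | c x != 0].
Proof.
move=> [s sc]; apply: (sub_finite_set _ (finite_fset s)) => x /= cx.
by apply: contraNT cx => /sc ->.
Qed.

Lemma fin_suppD c d : fin_supp c -> fin_supp d -> fin_supp (c + d).
Proof.
move=> [s sc] [s' sd]; exists (s `|` s')%fset => x; rewrite in_fsetU negb_or => /andP[xs xs'].
by rewrite [LHS]/(c x + d x) sc// sd// addr0.
Qed.

Lemma fin_suppZ a c : fin_supp c -> fin_supp (a *: c).
Proof. by move=> [s sc]; exists s => x /sc xc; rewrite [LHS]/(a * c x) xc; exact: mulr0. Qed.

Lemma wsumD f c d : fin_supp c -> fin_supp d -> wsum f (c + d) = wsum f c + wsum f d.
Proof.
move=> [s sc] [s' sd].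
have sc' x : x \notin (s `|` s')%fset -> c x = 0 by rewrite in_fsetU negb_or => /andP[/sc].
have sd' x : x \notin (s `|` s')%fset -> d x = 0 by rewrite in_fsetU negb_or => /andP[_ /sd].
rewrite (wsumE f sc') (wsumE f sd') (@wsumE (s `|` s')%fset).
  by rewrite -big_split /=; apply: eq_bigr => x _; rewrite -mulrDr.
by move=> x xs; rewrite [LHS]/(c x + d x) sc'// sd'// addr0.
Qed.

Lemma wsumZ f a c : fin_supp c -> wsum f (a *: c) = a * wsum f c.
Proof.
move=> [s sc]; rewrite (wsumE f sc) (@wsumE s) ?mulr_sumr.
  by apply: eq_bigr => x _; rewrite mulrCA.
by move=> x xs; rewrite [LHS]/(a * c x) sc//; exact: mulr0.
Qed.

Lemma fin_supp0 : fin_supp 0. Proof. by exists fset0. Qed.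

Lemma wsum0 f : wsum f 0 = 0.
Proof. by rewrite (@wsumE fset0)// big_seq_fset0. Qed.

Lemma wsum_sum (I : Type) (r : seq I) f (a : I -> rat) (b : I -> T -> rat^o) :
  (forall i, fin_supp (b i)) ->
  fin_supp (\sum_(i <- r) a i *: b i) /\
  wsum f (\sum_(i <- r) a i *: b i) = \sum_(i <- r) a i * wsum f (b i).
Proof.
move=> fb; elim: r => [|i r [fr IHr]].
  by rewrite !big_nil wsum0; split=> //; exact: fin_supp0.
rewrite !big_cons wsumD// ?IHr ?wsumZ//; last exact: fin_suppZ.
by split=> //; apply: fin_suppD => //; exact: fin_suppZ.
Qed.

End WeightedSum.

Section ReducedBetti.
Variables (R : realType) (T : topologicalType) (I : finType) (comp : T -> I).
Local Open Scope classical_set_scope.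
Local Open Scope ring_scope.
(** Together with [path_comp], this makes the fibres of [comp] the path components. *)
Hypothesis comp_path : forall s : continuousType (unit_itv R) T,
  comp (s one) = comp (s zero).
Hypothesis path_comp : forall x y : T, comp x = comp y ->
  exists s : continuousType (unit_itv R) T, s zero = x /\ s one = y.

Local Notation E := (T -> rat^o).
Local Notation V := (@reduced_cycles0 T).
Local Notation W := (@boundaries0 R T).
Local Notation pt := (@point_chain T).

Definition comp_image : {set I} := [set i | `[< exists x, comp x = i >]]%SET.

Let mass (i : I) : E -> rat := wsum (fun x => (comp x == i)%:R).

Lemma fin_supp_point x : fin_supp (pt x).
Proof.
exists [fset x]%fset => y; rewrite in_fset1 => /negbTE yx.
by rewrite /point_chain yx.
Qed.

Lemma wsum_point f x : wsum f (pt x) = f x.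
Proof.
rewrite (@wsumE _ [fset x]%fset) ?big_seq_fset1.
  by rewrite /point_chain eqxx mulr1.
by move=> y; rewrite in_fset1 => /negbTE yx; rewrite /point_chain yx.
Qed.

Lemma fin_suppB x y : fin_supp (pt x - pt y).
Proof.
rewrite -scaleN1r; apply: fin_suppD; first exact: fin_supp_point.
by apply: fin_suppZ; exact: fin_supp_point.
Qed.

Lemma wsum_pointB f x y : wsum f (pt x - pt y) = f x - f y.
Proof.
rewrite -scaleN1r wsumD ?wsumZ ?wsum_point ?mulN1r//; try exact: fin_supp_point.
by apply: fin_suppZ; exact: fin_supp_point.
Qed.

Lemma boundary_mass i c : W c -> fin_supp c /\ mass i c = 0.
Proof.
move=> [n [a [s ->]]]; rewrite /mass.
have [fs ->] := @wsum_sum T 'I_n (index_enum _) (fun x => (comp x == i)%:R) a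
  (fun i => pt (s i one) - pt (s i zero)) (fun i => fin_suppB _ _).
by split=> //; rewrite big1// => j _; rewrite wsum_pointB comp_path subrr mulr0.
Qed.

Lemma reduced_betti0_empty : (T -> False) -> reduced_betti0 R T = 0%E.
Proof.
move=> T0; apply/eqP; rewrite eq_le; apply/andP; split; last first.
  by apply: le_ereal_inf_tmp => _ [B _ <-]; exact: counting_ge0.
apply: ereal_inf_lbound; exists set0; last first.
  by rewrite /counting asboolT// fset_set0.
split=> // [v Vv|n a b B0]; last by move=> _ _ i; case: (B0 i).
exists 0%N, (fun=> 0), (fun=> 0); split; first by case.
exists 0%N, (fun=> 0), (fun i : 'I_0 => False_rect _ (notF (ltn_ord i))).
by apply/funext => x; case: (T0 x).
Qed.

Section Nonempty.
Variable x0 : T.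
Let i0 := comp x0.
Let z (i : I) : T := xget x0 [set x | comp x = i].
Let A' : {set I} := (comp_image :\ i0)%SET.
Let vv i : E := pt (z i) - pt (z i0).

Lemma comp_z i : i \in comp_image -> comp (z i) = i.
Proof.
by rewrite inE => /asboolP ci; have := xgetPex x0 ci.
Qed.

Lemma comp_in x : comp x \in comp_image.
Proof. by rewrite inE; apply/asboolP; exists x. Qed.

Lemma mass_vv i j : i \in A' -> j \in A' -> mass i (vv j) = (j == i)%:R.
Proof.
move=> /setD1P[ii0 iA] /setD1P[ji0 jA]; rewrite /mass /vv wsum_pointB !comp_z ?comp_in//.
by rewrite [i0 == i]eq_sym (negbTE ii0) subr0.
Qed.

Lemma cycle_vv j : V (vv j).
Proof.
split; first by apply: finite_fin_supp; exact: fin_suppB.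
by rewrite -wsum1 wsum_pointB subrr.
Qed.

(* The masses of the components vanish on boundaries, and separate the differences
   of representatives of the components. *)
Lemma basis_ge B : quotient_basis V W B -> ((#|A'|)%:R%:E <= counting B :> \bar R)%E.
Proof.
move=> [BV Bspan _]; rewrite /counting; case: asboolP => [fB|_]; last exact: leey.
rewrite lee_fin ler_nat; set e := enum_fset (fset_set B).
have Bfin b : B b -> fin_supp b by move=> /BV[fb _]; exact: fin_suppP.
(* Rows are the masses of the elements of B. Column rank #|A'| forces at least as many rows. *)
pose M : 'M[rat]_(size e, #|A'|) := \matrix_(j, l) mass (enum_val l) (nth 0 e j).
suff : row_full M.
  rewrite /row_full => /eqP <-; exact: rank_leq_row.
rewrite -sub1mx; apply/row_subP => l.
(* Boundaries have mass 0, so a spanning expression for the cycle [vv] writes its mass row, a unit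
   row, through the rows of M. *)
have [n [a [b [bB /(boundary_mass _) vW]]]] := Bspan _ (cycle_vv (enum_val l)).
have bi i : (index (b i) e < size e)%N.
  by rewrite index_mem; have := mem_set (bB i); rewrite -in_fset_set.
have -> : row l 1%:M = \sum_i a i *: row (Ordinal (bi i)) M.
  apply/rowP => k; rewrite !mxE summxE.
  have [fs ms] := @wsum_sum T 'I_n (index_enum _)
    (fun x => (comp x == enum_val k)%:R) a b (fun i => Bfin _ (bB i)).
  have [fw mw] := vW (enum_val k).
  rewrite -(inj_eq enum_val_inj) -mass_vv ?enum_valP// -[vv _](subrK (\sum_i a i *: b i)).
  rewrite /mass wsumD// -/(mass _ _) mw add0r ms.
  by apply: eq_bigr => i _; rewrite !mxE nth_index// -index_mem.
by apply: summx_sub => i _; apply: scalemx_sub; exact: row_sub.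
Qed.

Definition betti_basis : set E := [set` [seq vv i | i <- enum A']].

Lemma counting_betti_basis : (counting betti_basis <= (#|A'|)%:R%:E :> \bar R)%E.
Proof.
have fB : finite_set betti_basis by exact: finite_seq.
rewrite /counting asboolT// lee_fin ler_nat cardE -(size_map vv).
apply: uniq_leq_size; first exact: fset_uniq.
by move=> x; rewrite in_fset_set// => /set_mem.
Qed.

(** Modulo boundaries each point moves to the representative of its component, so a cycle is
    determined by its masses; for independence, the mass of a component isolates one coefficient. *)
Lemma betti_basisP : quotient_basis V W betti_basis.
Proof.
split=> [_ /mapP[i _ ->]|v [/fin_suppP[S vS] v0]|n a b bB bI Wab i].
- exact: cycle_vv.
- exists #|A'|, (fun l => mass (enum_val l) v), (fun l => vv (enum_val l)); split.
    by move=> l; apply/mapP; exists (enum_val l); rewrite ?mem_enum ?enum_valP.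
  have sv : \sum_(x <- S) (v x : rat) = 0.
    transitivity (wsum (fun=> 1) v); last by rewrite wsum1.
    by rewrite (wsumE _ vS); apply: eq_bigr => x _; rewrite mul1r.
  rewrite -(big_enum_val (fun i => mass i v *: vv i)).
  (* The term of [i0] may be added because [vv i0] is 0, and the multiples of [pt (z i0)] cancel
     because the total mass of v is 0. *)
  have -> : \sum_(i in A') mass i v *: vv i = \sum_(x <- S) v x *: pt (z (comp x)).
    transitivity (\sum_(i in comp_image) mass i v *: vv i).
      have vv0 : vv i0 = 0 by exact: subrr.
      rewrite [RHS](bigD1 i0) ?comp_in//= vv0 scaler0 add0r.
      by apply: eq_bigl => i; rewrite !inE andbC.
    transitivity (\sum_(i in comp_image) \sum_(x <- S) ((comp x == i)%:R * v x) *: vv i).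
      by apply: eq_bigr => i _; rewrite /mass (wsumE _ vS) scaler_suml.
    rewrite exchange_big /=; transitivity (\sum_(x <- S) v x *: vv (comp x)).
      apply: eq_bigr => x _; rewrite (bigD1 (comp x)) ?comp_in//= eqxx mul1r.
      by rewrite big1 ?addr0// => i /andP[_ /negbTE ix]; rewrite eq_sym ix mul0r scale0r.
    transitivity (\sum_(x <- S) ((v x : rat) *: pt (z (comp x)) - (v x : rat) *: pt (z i0))).
      by apply: eq_bigr => x _; exact: scalerBr.
    by rewrite big_split /= sumrN -scaler_suml sv scale0r subr0.
  have vE : v = \sum_(x <- S) v x *: pt x.
    apply/funext => y; rewrite fct_sumE.
    have [yS|yS] := boolP (y \in S); last first.
      rewrite vS// big_seq big1// => x xS; rewrite [LHS]/((v x : rat) * (y == x)%:R).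
      by case: eqVneq => [yx|_]; [rewrite yx xS in yS|exact: mulr0].
    rewrite (big_fsetD1 y)//= big_seq big1 ?addr0 => [|x].
      by apply/esym; rewrite [LHS]/((v y : rat) * (y == y)%:R) eqxx; exact: mulr1.
    rewrite !inE => /andP[xy _]; rewrite [LHS]/((v x : rat) * (y == x)%:R).
    by rewrite eq_sym (negbTE xy); exact: mulr0.
  have -> : v - \sum_(x <- S) v x *: pt (z (comp x)) =
    \sum_(x <- S) (v x : rat) *: (pt x - pt (z (comp x))).
    rewrite {1}vE -sumrB; apply: eq_bigr => x _; exact/esym/scalerBr.
  (* The difference is the boundary of paths from the representatives to the points of the
     support. *)
  have sP x : exists s : continuousType (unit_itv R) T, s zero = z (comp x) /\ s one = x.
    by apply: path_comp; rewrite comp_z ?comp_in.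
  exists (size S), (fun j => v (tnth (in_tuple S) j)),
    (fun j => sval (cid (sP (tnth (in_tuple S) j)))).
  rewrite big_tnth; apply: eq_bigr => j _.
  by case: cid => s /= [-> ->].
- have bv j : exists2 l, l \in A' & b j = vv l.
    by have /mapP[l] := bB j; rewrite mem_enum => lA ->; exists l.
  have [l lA bl] := bv i; have [_ ml] := boundary_mass l Wab.
  have [_] := @wsum_sum T 'I_n (index_enum _) (fun x => (comp x == l)%:R) a b
    (fun j => let: ex_intro2 _ _ e := bv j in eq_ind_r (@fin_supp T) (fin_suppB _ _) e).
  rewrite -/(mass l _) ml (bigD1 i)//= big1 ?addr0.
    by rewrite bl -/(mass l _) mass_vv// eqxx mulr1.
  move=> j ji; have [l' lA' bl'] := bv j.
  rewrite bl' -/(mass l _) mass_vv//; case: eqVneq => [ll'|_]; last by rewrite mulr0.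
  by move: ji; rewrite -(inj_eq bI) bl bl' ll' eqxx.
Qed.

Lemma reduced_betti0_nonempty : reduced_betti0 R T = (#|A'|)%:R%:E.
Proof.
apply/eqP; rewrite eq_le; apply/andP; split; last first.
  by apply: le_ereal_inf_tmp => _ [B Bb <-]; exact: basis_ge.
apply: le_trans counting_betti_basis; apply: ereal_inf_lbound.
by exists betti_basis => //; exact: betti_basisP.
Qed.
End Nonempty.

(** The truncated predecessor also gives the value 0 for the empty space. *)
Lemma reduced_betti0E : reduced_betti0 R T = (#|comp_image|.-1)%:R%:E.
Proof.
have [[x0 _]|T0] := pselect (exists x0 : T, True).
  by rewrite (reduced_betti0_nonempty x0) (cardsD1 (comp x0) comp_image) comp_in.
rewrite reduced_betti0_empty; last by move=> x; apply: T0; exists x.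
suff -> : comp_image = finset.set0 by rewrite cards0.
by apply/setP => i; rewrite !inE; apply/asboolP => -[x]; case: T0; exists x.
Qed.
End ReducedBetti.

(** * Path components of the realization and roots of the edge graph *)

Section BettiRoots.
Variables (R : realType) (m : nat) (K : {set {set 'I_m}}).
Hypothesis K_complex : simplicial_complex K.
Variable J : {set 'I_m}.
Local Open Scope classical_set_scope.
Local Open Scope ring_scope.
Local Notation X := (realization R (full_subcomplex K J)).
Local Notation T := (full_realization R K J).

Definition component_root (x : T) : 'I_m :=
  fingraph.root (edge K J) (sval (cid (realization_nonzero (set_valP x)))).

Lemma component_rootE (x : T) i : \val x ord0 i != 0 ->
  component_root x = fingraph.root (edge K J) i.
Proof.
move=> xi; rewrite /component_root; set j := sval _.
have xj : \val x ord0 j != 0 := svalP (cid (realization_nonzero (set_valP x))).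
apply/eqP; rewrite root_connect ?connect1//; last exact: edge_connect_sym.
exact: (realization_edge K_complex (set_valP x)).
Qed.

Lemma component_root_path (x y : T) : path_component R x y ->
  component_root x = component_root y.
Proof.
move=> xy; have [i xi] := realization_nonzero (set_valP x).
have [j yj] := realization_nonzero (set_valP y).
have [s [ps ls]] := curve_between_components K_complex xi yj xy.
rewrite (component_rootE xi) (component_rootE yj).
apply/eqP; rewrite root_connect; last exact: edge_connect_sym.
by apply/connectP; exists s.
Qed.

Lemma path_component_root (x y : T) : component_root x = component_root y ->
  path_component R x y.
Proof.
have [i xi] := realization_nonzero (set_valP x).
have [j yj] := realization_nonzero (set_valP y).
rewrite (component_rootE xi) (component_rootE yj) => /eqP.
rewrite root_connect; last exact: edge_connect_sym.
move=> /connectP[s ps sj]; rewrite sj in yj.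
(* A constant functor into the group on no generators; only the curve produced by [realize_path]
   matters here. *)
have tF : @functorial m K (pgroup (set0 : set (word 'I_0))) J (fun _ _ => 1%g).
  by move=> a b c _; rewrite mulg1.
have [g [cg _]] := realize_path K_complex tF ps (set_valP x) (set_valP y) xi yj.
by apply/path_componentP; exists g.
Qed.

Lemma component_root_image :
  comp_image component_root = [set i in J | fingraph.root (edge K J) i == i]%SET.
Proof.
apply/setP => i; rewrite !inE; apply/asboolP/andP => [[x <-]|[iJ /eqP ri]].
  have [j xj] := realization_nonzero (set_valP x); rewrite (component_rootE xj).
  have /and3P[jJ _ _] := realization_edge K_complex (set_valP x) xj xj.
  by rewrite root_in// root_root//; exact: edge_connect_sym.
have Xi := midpoint_realization R (vertex_edge K_complex iJ).
exists (exist _ (midpoint R i i) (mem_set Xi)).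
by rewrite -[RHS]ri; apply: component_rootE; rewrite midpoint_neq0 !inE eqxx.
Qed.

(** The predecessor takes away the main root; for empty J both sides are 0. *)
Lemma card_component_roots :
  #|[set i in J | fingraph.root (edge K J) i == i]%SET|.-1 =
  #|[set i | other_root K J i]%SET|.
Proof.
case mJ: (main_root K J) => [r|]; last first.
  rewrite /main_root in mJ; case: pickP mJ => // J0 _.
  by rewrite !eq_card0// => i; rewrite !inE /other_root (J0 i).
rewrite (cardsD1 r [set i in J | _]%SET) !inE (main_root_in mJ) (main_root_root mJ) eqxx /=.
congr #|pred_of_set _|; apply/setP => i; rewrite !inE /other_root mJ andbC -andbA.
by congr [&& _, _ & _]; rewrite eq_sym.
Qed.

Lemma b0E : b0 R K J = #|[set i | other_root K J i]%SET|%:R%:E.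
Proof.
rewrite /b0 (@reduced_betti0E R T _ component_root).
- by rewrite component_root_image card_component_roots.
- move=> s; apply/esym/component_root_path.
  by squash (mk_path (@cts_fun _ _ s) erefl erefl : {path unit_itv R from s zero to s one in T}).
- move=> x y /path_component_root[p]; exists p; split; [exact: path_zero|exact: path_one].
Qed.

Lemma other_roots_enum : exists rt : below (b0 R K J) -> 'I_m, injective rt /\
  forall i, other_root K J i <-> exists k, rt k = i.
Proof.
have lt_b0 n : (n%:R%:E < b0 R K J)%E = (n < #|[set i | other_root K J i]%SET|)%N.
  by rewrite b0E lt_below.
have kn (k : below (b0 R K J)) : (val k < #|[set i | other_root K J i]%SET|)%N.
  by rewrite -lt_b0; exact: valP k.
exists (fun k => enum_val (Ordinal (kn k))); split.
  by move=> k k' /enum_val_inj/(congr1 val) kk'; apply/val_inj; exact: kk'.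
move=> i; split=> [oi|[k <-]]; last first.
  by have := enum_valP (Ordinal (kn k)); rewrite inE.
have iO : i \in [set i | other_root K J i]%SET by rewrite inE.
have ib : ((enum_rank_in iO i)%:R%:E < b0 R K J)%E by rewrite lt_b0.
exists (exist (fun k : nat => (k%:R%:E < b0 R K J)%E) (enum_rank_in iO i : nat) ib).
rewrite -[RHS](enum_rankK_in iO iO).
by congr enum_val; apply/val_inj.
Qed.
End BettiRoots.

(** * Cardinalities *)

Section Counting.
Variable R : realType.
Local Open Scope classical_set_scope.
Local Open Scope ereal_scope.
Local Notation count T := (counting [set: T] : \bar R).

Lemma counting_bij (T : choiceType) (F : finType) (f : F -> T) :
  bijective f -> count T = #|F|%:R%:E.
Proof.
move=> [g fK gK]; have fT : finite_set [set: T].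
  suff -> : [set: T] = [set` [seq f i | i <- enum F]] by exact: finite_seq.
  apply/seteqP; split=> // x _; apply/mapP; exists (g x); rewrite ?gK//.
  by rewrite mem_enum.
rewrite /counting asboolT// cardE -(size_map f); congr (_%:R%:E).
apply/perm_size/uniq_perm; first exact: fset_uniq.
  by rewrite map_inj_uniq ?enum_uniq//; exact: can_inj fK.
move=> x; rewrite in_fset_set// in_setT; apply/esym/mapP.
by exists (g x); rewrite ?gK// mem_enum.
Qed.

Lemma counting_ord (T : choiceType) n : count T = n%:R%:E ->
  exists f : 'I_n -> T, bijective f.
Proof.
rewrite /counting; case: asboolP => // fT /eqP; rewrite eqe eqr_nat => /eqP sT.
set s := enum_fset _ in sT.
have sx x : x \in s by rewrite in_fset_set// in_setT.
have ix x : (index x s < n)%N by rewrite -sT index_mem.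
exists (fun i => tnth (in_tuple s) (cast_ord (esym sT) i)).
exists (fun x => Ordinal (ix x)) => [i|x].
  apply/val_inj => /=; rewrite (tnth_nth (tnth (in_tuple s) (cast_ord (esym sT) i))) /=.
  by rewrite index_uniq ?fset_uniq// sT.
by rewrite (tnth_nth x) /= nth_index.
Qed.

Lemma counting_inj (T U : choiceType) (f : T -> U) :
  injective f -> count T = +oo -> count U = +oo.
Proof.
move=> fI; rewrite /counting; case: asboolP => // iT _.
case: asboolP => // fU; case: iT.
have : finite_set (f @^-1` [set: U]) by apply: finite_preimage => // x y _ _; exact: fI.
by apply: sub_finite_set.
Qed.

Lemma counting_eq0 (T : choiceType) : count T = 0 <-> (T -> False).
Proof.
split=> [/(@counting_ord _ 0)[f [g _ _]] x|T0]; first by case: (g x).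
rewrite -[0]/(0%:R%:E) -[0%N](card_ord 0).
apply: (@counting_bij T 'I_0 (fun i => False_rect _ (notF (ltn_ord i)))).
by exists (fun x => False_rect _ (T0 x)) => [i|x]; [case: (notF (ltn_ord i))|case: (T0 x)].
Qed.

Lemma counting_set (T : choiceType) (P : pred T) :
  count {x : T | P x} = counting [set x | P x].
Proof.
have [inf|[n cn]] := counting_nat R [set x | P x].
  rewrite inf /counting; case: asboolP => // fS.
  move: inf; rewrite /counting; case: asboolP => // -[].
  suff -> : [set x | P x] = val @` [set: {x : T | P x}] by exact: finite_image.
  by apply/seteqP; split=> [x Px|_ [x _ <-]]; [exists (exist _ x Px)|exact: valP].
rewrite cn; move: cn; rewrite /counting; case: asboolP => // fP /eqP.
rewrite eqe eqr_nat => /eqP sP.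
have sub : finite_set [set: {x : T | P x}].
  have : finite_set ((\val : {x : T | P x} -> T) @^-1` [set x | P x]).
    by apply: finite_preimage => // x y _ _; exact: val_inj.
  by apply: sub_finite_set => x _; exact: valP.
rewrite asboolT// -sP -(size_map val); congr (_%:R%:E); apply/perm_size/uniq_perm.
- by rewrite map_inj_uniq ?fset_uniq//; exact: val_inj.
- exact: fset_uniq.
- move=> x; rewrite in_fset_set//; apply/mapP/idP => [[y _ ->]|].
    by apply/mem_set; exact: valP.
  by move=> /set_mem Px; exists (exist _ x Px); rewrite // in_fset_set// in_setT.
Qed.

Lemma counting_below x : (x = +oo \/ exists n, x = n%:R%:E) -> count (below x) = x.
Proof.
move=> [->|[n ->]].
  apply: (@counting_inj nat _ (fun k => exist _ k (ltry k%:R))); first by move=> k l [].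
  by rewrite /counting asboolF//; exact: infinite_nat.
rewrite -[in RHS](card_ord n).
have lt (i : 'I_n) : ((i : nat)%:R%:E < n%:R%:E :> \bar R) by rewrite lt_below.
apply: (@counting_bij _ _ (fun i : 'I_n => exist (fun k => k%:R%:E < n%:R%:E) (i : nat) (lt i))).
have ltn (k : below (n%:R%:E : \bar R)) : (val k < n)%N by rewrite -(lt_below R); exact: valP k.
by exists (fun k => Ordinal (ltn k)) => [i|k]; exact: val_inj.
Qed.

(** Empty factors come first, in accordance with 0 * +oo = 0; then an infinite factor embeds by
    fixing a point of the other. *)
Lemma counting_prod (A B : choiceType) : count (A * B)%type = count A * count B.
Proof.
have prodC : count (A * B)%type = +oo -> count (B * A)%type = +oo.
  by apply: (@counting_inj _ _ (fun p => (p.2, p.1))) => -[a b] [a' b'] [-> ->].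
have empty (C D : choiceType) : count C = 0 -> count (C * D)%type = 0 /\ count (D * C)%type = 0.
  by move=> /counting_eq0 C0; split; apply/counting_eq0 => -[x y]; apply: C0.
have inf (C D : choiceType) : count C = +oo -> count D != 0 ->
    [/\ count (C * D)%type = +oo, count (D * C)%type = +oo & 0 < count D].
  move=> Ci D0; have [d _] : exists d : D, True.
    apply: contraPP D0 => nD; apply/negP; rewrite negbK; apply/eqP/counting_eq0 => d.
    by apply: nD; exists d.
  split; last by rewrite lt_neqAle eq_sym D0 counting_ge0.
    by apply: counting_inj Ci; instantiate (1 := fun c => (c, d)) => x y [].
  by apply: counting_inj Ci; instantiate (1 := fun c => (d, c)) => x y [].
have [A0|A0] := eqVneq (count A) 0; first by rewrite A0 mul0e (empty _ _ A0).1.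
have [B0|B0] := eqVneq (count B) 0; first by rewrite B0 mule0 (empty _ _ B0).2.
have [Ai|[a an]] := counting_nat R [set: A].
  by have [-> _ B1] := inf _ _ Ai B0; rewrite Ai gt0_mulye.
have [Bi|[b bn]] := counting_nat R [set: B].
  by have [_ -> A1] := inf _ _ Bi A0; rewrite Bi gt0_muley.
have [[f [f' fK f'K]] [g [g' gK g'K]]] := (counting_ord an, counting_ord bn).
rewrite (@counting_bij _ ('I_a * 'I_b)%type (fun p => (f p.1, g p.2))).
  by rewrite card_prod !card_ord natrM EFinM an bn.
by exists (fun p => (f' p.1, g' p.2)) => -[x y]; rewrite /= ?fK ?gK ?f'K ?g'K.
Qed.

Lemma counting_sigma (I : finType) (U : I -> choiceType) :
  count {i : I & U i} = \sum_(i : I) count (U i).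
Proof.
have [[i Ui]|Uf] := pselect (exists i, count (U i) = +oo).
  rewrite (bigD1 i)//= Ui addye; last first.
    rewrite -ltNye (@lt_le_trans _ _ 0)// sume_ge0// => j _.
    exact: counting_ge0.
  apply: counting_inj Ui; instantiate (1 := fun u => existT _ i u).
  by move=> u v /eqP; rewrite eq_Tagged => /eqP.
have Un i : exists n, count (U i) = n%:R%:E.
  by have [Ui|//] := counting_nat R [set: U i]; case: Uf; exists i.
pose n i := sval (cid (Un i)); have nE i : count (U i) = (n i)%:R%:E := svalP (cid (Un i)).
pose f i := sval (cid (counting_ord (nE i))).
have fb i : bijective (f i) := svalP (cid (counting_ord (nE i))).
have finv i : {g | cancel (f i) g & cancel g (f i)}.
  by apply: cid2; case: (fb i) => g; exists g.
pose g i := s2val (finv i).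
have fK i : cancel (f i) (g i) := s2valP (finv i).
have gK i : cancel (g i) (f i) := s2valP' (finv i).
rewrite (@counting_bij _ {i : I & 'I_(n i)} (fun p => existT _ (tag p) (f _ (tagged p)))).
  rewrite card_tagged sumnE big_map -big_enum natr_sum -sumEFin /=.
  by apply: eq_big => // i _; rewrite card_ord nE.
by exists (fun p => existT _ (tag p) (g _ (tagged p))) => -[i x] /=; rewrite ?fK ?gK.
Qed.

Lemma counting_ge1 (T : choiceType) : count T != 0 -> 1 <= count T.
Proof.
have [->|[n ->]] := counting_nat R [set: T]; first by rewrite leey.
by rewrite eqe pnatr_eq0 lee_fin ler1n lt0n.
Qed.

(** V is kept apart from the dependent product, so that the choice structure of [n_type] can be used
    with h the identity. *)
Lemma counting_forall (I : finType) (U : I -> choiceType) (V : choiceType)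
    (h : V -> forall i, U i) : bijective h ->
  count V = \prod_(i : I) count (U i).
Proof.
move=> [h' hK h'K]; have [[i Ui]|U0] := pselect (exists i, count (U i) = 0).
  rewrite (bigD1 i)//= Ui mul0e; apply/counting_eq0 => v.
  by move/counting_eq0 : Ui; apply; exact: (h v i).
have {}U0 i : count (U i) != 0 by apply/eqP => Ui; apply: U0; exists i.
have pt i : exists u : U i, True.
  apply: contraPP (U0 i) => nU; apply/negP; rewrite negbK; apply/eqP/counting_eq0 => u.
  by apply: nU; exists u.
pose u0 i := sval (cid (pt i)).
have [[i Ui]|Uf] := pselect (exists i, count (U i) = +oo).
  rewrite (bigD1 i)//= Ui gt0_mulye; last first.
    apply: (@lt_le_trans _ _ 1) => //; elim/big_ind: _ => // [x y x1 y1|j _].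
      by rewrite -[1]mule1; apply: lee_pmul.
    exact: counting_ge1.
  (* The infinite factor embeds by filling the other coordinates with the points [u0]. *)
  apply: (counting_inj (f := fun u => h' (@eqtype.dfwith _ (fun i => U i : Type) u0 i u)) _ Ui).
  move=> u v /(can_inj h'K) /(congr1 (fun w => w i)) /=.
  by rewrite !dfwith_in.
have Un i : exists n, count (U i) = n%:R%:E.
  by have [Ui|//] := counting_nat R [set: U i]; case: Uf; exists i.
pose n i := sval (cid (Un i)); have nE i : count (U i) = (n i)%:R%:E := svalP (cid (Un i)).
pose f i := sval (cid (counting_ord (nE i))).
have fb i : bijective (f i) := svalP (cid (counting_ord (nE i))).
have finv i : {g | cancel (f i) g & cancel g (f i)}.
  by apply: cid2; case: (fb i) => g; exists g.
pose g i := s2val (finv i).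
have fK i : cancel (f i) (g i) := s2valP (finv i).
have gK i : cancel (g i) (f i) := s2valP' (finv i).
rewrite (@counting_bij _ {dffun forall i : I, 'I_(n i)} (fun p => h' (fun i => f i (p i)))).
  rewrite card_dep_ffun foldrE big_map big_enum /= natr_prod.
  rewrite (big_morph EFin (@EFinM R) erefl); apply: eq_bigr => i _.
  by rewrite card_ord nE.
exists (fun v => [ffun i => g i (h v i)]) => [p|v].
  by apply/ffunP => i; rewrite ffunE h'K fK.
rewrite -[RHS]hK; congr h'; apply/functional_extensionality_dep => i.
by rewrite ffunE gK.
Qed.
End Counting.

(** * Assembling the presentation and its numbers *)

Section Assembly.
Variables (R : realType) (m : nat) (K : {set {set 'I_m}}).
Hypothesis K_complex : simplicial_complex K.
Variable G : 'I_m -> groupType.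
Local Open Scope classical_set_scope.
Local Open Scope ereal_scope.
Implicit Type J : {set 'I_m}.

Lemma Cart_relators : exists r : relators R K G -> word (generators R K G),
  presents r (Cart K G).
Proof.
pose rt J := sval (cid (other_roots_enum R K_complex J)).
have [rt_inj rtP] : (forall J, injective (rt J)) /\
    (forall J i, other_root K J i <-> exists k, rt J k = i).
  by split=> J; have [] := svalP (cid (other_roots_enum R K_complex J)).
pose loops J := sval (cid (loops_of_rank R K_complex J)).
have [closed gen] : (forall J k s b, (s, b) \in loops J k -> closed_path K J s) /\
    (forall J (H : groupType) (t : 'I_m -> 'I_m -> H), functorial K J t ->
      (forall k, weval (loop_prod t) (loops J k) = 1%g) ->
      forall a s s', path (edge K J) a s -> path (edge K J) a s' ->
      last a s = last a s' -> path_prod t a s = path_prod t a s').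
  by split=> J; have [] := svalP (cid (loops_of_rank R K_complex J)).
exists (@relator m K G _ _ rt loops).
exact: Cart_presented.
Qed.

Lemma counting_n_type J : counting [set: n_type G J] = n_ R G J :> \bar R.
Proof.
rewrite (@counting_forall R _ (fun j : {j | j \in J} => {g : G (val j) | g != 1%g}) _ id).
  rewrite /n_ [RHS]big_sub; apply: eq_bigr => j _.
  exact: counting_set.
by exists id.
Qed.

Lemma counting_weighted (b : {set 'I_m} -> \bar R) :
  (forall J, b J = +oo \/ exists n, b J = n%:R%:E) ->
  counting [set: {J : {set 'I_m} & (n_type G J * below (b J))%type}] =
  \sum_(J : {set 'I_m}) n_ R G J * b J.
Proof.
move=> bn; rewrite counting_sigma; apply: eq_bigr => J _.
by rewrite counting_prod counting_below// counting_n_type.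
Qed.

Lemma counting_generators : counting [set: generators R K G] = N_ R K G.
Proof.
by apply: counting_weighted => J; right; rewrite b0E//; eexists.
Qed.

Lemma counting_relators : counting [set: relators R K G] = Mplus_ R K G.
Proof.
apply: counting_weighted => J; rewrite /rk.
by have [->|[n [-> _]]] := grank_nat R (Pi1 R (full_realization R K J)); [left|right; exists n].
Qed.
End Assembly.

Theorem theorem1p1 (R : realType) (m : nat) (K : {set {set 'I_m}})
    (K_complex : simplicial_complex K) (K_flag : flag K)
    (G : 'I_m -> groupType) :
  (exists r : relators R K G -> word (generators R K G),
     presents r (Cart K G)) /\
  (deficiency R (Cart K G) <= (Mplus_ R K G - N_ R K G)%dE)%E.
Proof.
have [r rP] := Cart_relators R K_complex G.
split; first by exists r.
(* The presentation just found is one of those over which the infimum runs. *)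
apply: ereal_inf_lbound; exists (generators R K G), (relators R K G), r.
by rewrite counting_relators counting_generators.
Qed.
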